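(* Let $a\in\mathbb{R}$, $a\neq 0$. The rotational linear Weingarten surfaces in $\mathbb{R}^3$ satisfying the relation $\kappa_1=a\kappa_2$ are planes, ovaloids (including spheres) and catenoid-type surfaces. More precisely, if the surface is not a plane and $\gamma$ is its generating curve, then: 1. Case $a>0$. The curve $\gamma$ is a concave graph on the $z$-axis of a function defined on a bounded interval. The rotational surface is an ovaloid. If $a=1$, then the surface is a round sphere. 2. Case $a<0$. The curve $\gamma$ is a convex graph on the $z$-axis. If $-1\le a<0$, then $\gamma$ is the graph of a function defined on the entire $z$-axis, and if $a<-1$, the function is defined on a bounded interval of the $z$-axis, the curve being asymptotic to two parallel lines. In both cases, the surface is of catenoid-type.
   Context: The rotational axis is the $z$-axis and the generating curve $\gamma(s)=(x(s),0,z(s))$ lies in the $xz$-plane, is parametrized by arc length, has $x>0$, and $x'=\cos\theta$, $z'=\sin\theta$. The principal curvatures of the surface of revolution are $\kappa_1=\theta'$ (curvature of the profile curve) and $\kappa_2=\sin\theta/x$ (normal curvature of the orbits of the rotation), so $\kappa_1=a\kappa_2$ is equivalent to the system $$x'=\cos\theta,\quad z'=\sin\theta,\quad \theta'=a\frac{\sin\theta}{x}.$$ The generating curves considered are the maximal solutions of this system; if such a curve tends to a point of the $z$-axis, that point is added to the curve and to the surface. ''Graph on the $z$-axis'' means that $\gamma$ is a curve $x=x(z)$, with $x$ a function of $z$ on an interval of the $z$-axis. Ovaloid: a closed convex surface of genus $0$ meeting the axis of rotation orthogonally at its two poles (round spheres are included). Catenoid-type surface: a rotational surface not meeting the axis whose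 generating curve is a graph $x=x(z)$ bending away from the axis ($x(z)$ a convex function) on an interval of the axis, which is either the whole axis $\mathbb{R}$ or a bounded interval. *)

(* Defs.v *)
From mathcomp Require Import all_boot all_order all_algebra.
From mathcomp Require Import all_classical all_reals all_analysis.

Set Implicit Arguments.
Unset Strict Implicit.
Unset Printing Implicit Defensive.

Import Order.TTheory GRing.Theory Num.Theory.
Import numFieldNormedType.Exports.

Local Open Scope classical_set_scope.
Local Open Scope ring_scope.

                                                                     
                                                                            
                                                                               
                                                               

Section Curves.
Context {R : realType}.
Implicit Types (a s : R) (I J : set R) (x z th f : R -> R).

                                                                          
                                  
Definition profile_curve I x z th : Prop :=
  [/\ I !=set0, open I, is_interval I &
    forall s, I s ->
      [/\ 0 < x s, is_derive s 1 x (cos (th s)),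
          is_derive s 1 z (sin (th s)) & derivable th s 1] ].

                                                                              
                                    
Definition kappa1 th s : R := derive1 th s.
Definition kappa2 x th s : R := sin (th s) / x s.

Definition linear_weingarten a I x z th : Prop :=
  profile_curve I x z th /\
  forall s, I s -> kappa1 th s = a * kappa2 x th s.

Definition maximal_linear_weingarten a I x z th : Prop :=
  linear_weingarten a I x z th /\
  forall J x1 z1 th1, linear_weingarten a J x1 z1 th1 -> I `<=` J ->
    (forall s, I s -> [/\ x1 s = x s, z1 s = z s & th1 s = th s]) ->
    J `<=` I.

                                                                             
                                                   
Definition lower_end I : set_system R :=
  filter_from I (fun s0 => [set s | I s /\ s <= s0]).
Definition upper_end I : set_system R :=
  filter_from I (fun s0 => [set s | I s /\ s0 <= s]).

Definition generating_curve I x z : set (R * R) :=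
  [set (x s, z s) | s in I] `|`
  [set Q | Q.1 = 0 /\ ((x s, z s) @[s --> lower_end I] --> Q \/
                       (x s, z s) @[s --> upper_end I] --> Q)].

                                                                  
Definition zgraph J f : set (R * R) := [set (f t, t) | t in J].

Definition concave_function J f : Prop :=
  convex_function (J : set R) (fun t => - f t).

Definition line (P v : R * R) : set (R * R) := range (fun t : R => P + t *: v).

Definition asymptotic (F : set_system R) x z (L : set (R * R)) : Prop :=
  `|(x s, z s)| @[s --> F] --> +oo /\
  forall e : R, 0 < e ->
    \forall s \near F, exists2 Q, L Q & `|(x s, z s) - Q| < e.

Definition asymptotic_parallel_lines I x z : Prop :=
  exists P1 P2 v : R * R,
    [/\ v != 0, line P1 v <> line P2 v,
        asymptotic (lower_end I) x z (line P1 v) &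
        asymptotic (upper_end I) x z (line P2 v)].

End Curves.

Section Surfaces.
Context {R : realType}.
Local Notation R3 := (R * R * R)%type.
Implicit Types (S : set R3) (P Q n : R3).

Definition dot3 P Q : R := P.1.1 * Q.1.1 + P.1.2 * Q.1.2 + P.2 * Q.2.

Definition zaxis : set R3 := [set P | P.1 = 0].

Definition surface_of_revolution (G : set (R * R)) : set R3 :=
  [set P | exists2 Q, G Q & exists phi : R,
    P = (Q.1 * cos phi, Q.1 * sin phi, Q.2)].

Definition is_plane S : Prop :=
  exists n, exists2 d : R, n != 0 & S = [set P | dot3 n P = d].

Definition round_sphere (c : R3) (r : R) : set R3 :=
  [set P | dot3 (P - c) (P - c) = r ^+ 2].

Definition is_round_sphere S : Prop :=
  exists c, exists2 r : R, 0 < r & S = round_sphere c r.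

Definition homeomorphic (T U : topologicalType) (A : set T) (B : set U) : Prop :=
  exists (f : T -> U) (g : U -> T),
    [/\ {within A, continuous f}, {within B, continuous g},
        (forall t, A t -> B (f t) /\ g (f t) = t) &
        (forall u, B u -> A (g u) /\ f (g u) = u)].

Definition closed_genus0 S : Prop := homeomorphic (round_sphere 0 1) S.

Definition convex_surface S : Prop :=
  exists K : set R3,
    [/\ compact K, convex_set K, K° !=set0 & S = closure K `\` K°].

                                                             
Definition tangent_normal S P n : Prop :=
  forall e : R, 0 < e ->
    \forall Q \near within S (nbhs P), `|dot3 n (Q - P)| <= e * `|Q - P|.

Definition is_ovaloid S : Prop :=
  [/\ closed_genus0 S, convex_surface S &
    exists p q : R, [/\ p < q, S `&` zaxis = [set (0, 0, p); (0, 0, q)],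
      tangent_normal S (0, 0, p) (0, 0, 1) &
      tangent_normal S (0, 0, q) (0, 0, 1)] ].

                                                      
Definition is_catenoid_type S : Prop :=
  exists (J : set R) (f : R -> R),
    [/\ J !=set0, open J, is_interval J & J = setT \/ bounded_set J] /\
    [/\ forall t, J t -> 0 < f t, convex_function (J : set R) f &
        S = surface_of_revolution (zgraph J f)].

End Surfaces.

(* Main.v *)
(* Differentiating shows that [x^(-a) sin th] is constant along the curve. If it
   vanishes, [th] is constant, the curve is a half-line orthogonal to the axis
   and the surface is a plane. Otherwise, up to a shift of [th] by a multiple of
   pi and a reversal of orientation, [th] stays in ]0, pi[, and [x] and [z] are
   explicit functions of the angle [t]: [x = X t = (e^(-kap) sin t)^(1/a)] and
   [dz/dt = X t / a], while [s] is up to sign and translation a primitive of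
   [X t / (a sin t)]. Inverting that primitive gives a solution on which the
   angle takes every value in ]0, pi[; by maximality the given curve is that
   solution. Convexity comes from the sign of the derivative
   [X t sin (t0 - t) / (a sin t)] of [X t sin t0 - Z t cos t0]. For [a > 0], [X]
   extends by [0] to [t = 0] and [t = pi], which are the poles. For [a < 0], [X]
   is infinite there, and [z] converges iff [sin^(1/a)] is integrable, i.e. iff
   [a < -1]. *)
Require Import Defs.
From mathcomp Require Import all_boot all_order all_algebra.
From mathcomp Require Import all_classical all_reals all_analysis.
From mathcomp Require Import ring lra.
Import Order.TTheory GRing.Theory Num.Theory.
Import numFieldNormedType.Exports.
Local Open Scope classical_set_scope.
Local Open Scope ring_scope.

Set Implicit Arguments.
Unset Strict Implicit.
Unset Printing Implicit Defensive.

(** * Calculus on intervals *)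

Section Calculus.
Context {R : realType}.
Implicit Types (I : set R) (f g : R -> R) (c d e l m s t x : R).

(** No uniqueness theorem for the differential system is invoked. The first integral alone separates
    planes from the other surfaces, and maximality is exploited by exhibiting a solution that agrees
    with the given curve on [I] and lives on a larger set. The profile [x = f(z)] is known only
    through its angle, so its second derivative is avoided: [X t sin t0 - Z t cos t0] measures the
    position along the normal at angle [t0], and an extremum at [t0] says that the tangent there
    supports the curve. The ovaloid claims concern a set in space. For [a > 0] the surface is
    therefore rewritten as [X^2 + Y^2 = f(Z)^2] over [[p, q]], with [f] continuous on the whole line
    and zero outside []p, q[]; interior, convexity, genus and tangency at the poles are then read
    off from [f]. *)

Lemma is_derive_continuous f x d : is_derive x 1 f d -> {for x, continuous f}.
Proof.
move=> fd; apply/differentiable_continuous/derivable1_diffP.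
exact: (@ex_derive _ _ _ _ _ _ _ fd).
Qed.

(** Derivatives are assembled as proof terms from the pointwise rules below; this lemma then leaves
    the identity between computed and wanted value to [ring] or [field]. *)
Lemma is_derive_eqfun f x d e : is_derive x 1 f d -> d = e -> is_derive x 1 f e.
Proof. by move=> ? <-. Qed.

Lemma is_deriveDfun f g x d e : is_derive x 1 f d -> is_derive x 1 g e ->
  is_derive x 1 (fun t => f t + g t) (d + e).
Proof. by move=> fd gd; have := is_deriveD fd gd. Qed.

Lemma is_deriveBfun f g x d e : is_derive x 1 f d -> is_derive x 1 g e ->
  is_derive x 1 (fun t => f t - g t) (d - e).
Proof. by move=> fd gd; have := is_deriveB fd gd. Qed.

Lemma is_deriveMfun f g x d e : is_derive x 1 f d -> is_derive x 1 g e ->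
  is_derive x 1 (fun t => f t * g t) (d * g x + f x * e).
Proof.
move=> fd gd; have := is_deriveM fd gd.
by rewrite addrC [_ *: d]mulrC.
Qed.

Lemma is_derive_compfun f g x d e : is_derive (g x) 1 f d -> is_derive x 1 g e ->
  is_derive x 1 (fun t => f (g t)) (d * e).
Proof. by move=> fd gd; have := is_derive1_comp fd gd. Qed.

Lemma is_derive_cstfun c x : is_derive x 1 (fun=> c) 0.
Proof. exact: is_derive_cst. Qed.

Lemma is_deriveZfun c f x d : is_derive x 1 f d ->
  is_derive x 1 (fun t => c * f t) (c * d).
Proof.
move=> fd; apply: (is_derive_eqfun (is_deriveMfun (is_derive_cstfun c x) fd)).
by rewrite mul0r add0r.
Qed.

Lemma is_derive_expln c f x d : 0 < f x -> is_derive x 1 f d ->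
  is_derive x 1 (fun t => expR (c * ln (f t))) (c * (d / f x) * expR (c * ln (f x))).
Proof.
move=> fx fd; apply: (is_derive_eqfun (is_derive_compfun (is_derive_expR _)
  (is_deriveZfun c (is_derive_compfun (is_derive1_ln fx) fd)))).
by rewrite mulrC; congr (_ * _); rewrite [d / _]mulrC.
Qed.

Lemma is_derive_MVT I f (df : R -> R) : is_interval I ->
  (forall s, I s -> is_derive s 1 f (df s)) ->
  forall s t, I s -> I t -> s < t ->
  exists2 u, I u & f t - f s = df u * (t - s).
Proof.
move=> itvI fd s t Is It st.
have sub u : u \in `[s, t] -> I u.
  by rewrite in_itv => /= ?; exact: itvI Is It _ _.
have [||u /subset_itv_oo_cc/sub Iu e] := @MVT R f df s t st.
- by move=> u /subset_itv_oo_cc/sub/fd.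
- apply: derivable_within_continuous => u /sub/fd fu.
  exact: (@ex_derive _ _ _ _ _ _ _ fu).
by exists u.
Qed.

Lemma derive0_cst I f : is_interval I ->
  (forall s, I s -> is_derive s 1 f 0) ->
  forall s t, I s -> I t -> f s = f t.
Proof.
move=> itvI fd s t Is It; wlog st : s t Is It / s < t.
  by move=> H; have [/H|/H/esym|->] := ltgtP s t; do ?exact.
have [u Iu] := is_derive_MVT itvI fd Is It st.
by rewrite mul0r => /eqP; rewrite subr_eq0 => /eqP ->.
Qed.

Lemma derive_gt0_incr I f (df : R -> R) : is_interval I ->
  (forall s, I s -> is_derive s 1 f (df s)) -> (forall s, I s -> 0 < df s) ->
  forall s t, I s -> I t -> s < t -> f s < f t.
Proof.
move=> itvI fd df0 s t Is It st.
have [u Iu e] := is_derive_MVT itvI fd Is It st.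
by rewrite -subr_gt0 e mulr_gt0 ?df0// subr_gt0.
Qed.

Lemma derive_ge0_ndecr I f (df : R -> R) : is_interval I ->
  (forall s, I s -> is_derive s 1 f (df s)) -> (forall s, I s -> 0 <= df s) ->
  forall s t, I s -> I t -> s <= t -> f s <= f t.
Proof.
move=> itvI fd df0 s t Is It; rewrite le_eqVlt => /predU1P[->//|st].
have [u Iu e] := is_derive_MVT itvI fd Is It st.
by rewrite -subr_ge0 e mulr_ge0 ?df0// subr_ge0 ltW.
Qed.

Let mu := @lebesgue_measure R.

(** Since [g] may fail to be integrable up to [l], no integral can start there. The base point [w t]
    moves with [t], staying to the left of both [t] and the midpoint [c]; subtracting the integral
    up to [c] makes the value independent of the base point. *)
Lemma antiderivative l m g : l < m ->
  (forall t, l < t < m -> {for t, continuous g}) ->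
  exists G : R -> R, forall t, l < t < m -> is_derive t 1 G (g t).
Proof.
move=> lm gc; pose c := (l + m) / 2.
have intg u v : l < u -> v < m -> mu.-integrable `[u, v] (EFin \o g).
  move=> lu vm; apply: continuous_compact_integrable.
    exact: segment_compact.
  apply: continuous_in_subspaceT => t /[1!inE]/= /[1!in_itv]/= /andP[ut tv].
  by apply: gc; rewrite (lt_le_trans lu)//= (le_lt_trans tv).
pose F w t := \int[mu]_(x in `[w, t]) g x.
pose w t := (l + Num.min t c) / 2.
pose G t := F (w t) t - F (w t) c.
have FB u v t : l < u -> u < v -> v < t -> t < m -> F u t - F v t = F u v.
  move=> lu uv vt tm; rewrite /F.
  have -> : \int[mu]_(x in `[v, t]) g x = \int[mu]_(x in `]v, t]) g x.
    rewrite Rintegral_itv_obnd_cbnd//.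
    apply: integrableS (intg v t (lt_trans lu uv) tm) => //.
    exact: subset_itv_oc_cc.
  rewrite -(@Rintegral_itvB _ g (BLeft u) (BRight t) v) // ?subKr//.

  - exact: intg.
  - by rewrite bnd_simp ltW.
  - by rewrite bnd_simp ltW.
have FI u v t : l < u -> u < v -> v < t -> v < c -> t < m ->
    F u t - F u c = F v t - F v c.
  move=> lu uv vt vc tm; have cm : c < m by rewrite /c; lra.
  by have := FB u v t lu uv vt tm; have := FB u v c lu uv vc cm; lra.
have FJ u v t : l < u -> l < v -> u < t -> v < t -> u < c -> v < c -> t < m ->
    F u t - F u c = F v t - F v c.
  move=> lu lv ut vt uc vc tm.
  by have [uv|uv|->//] := ltgtP u v; [exact: FI|exact/esym/FI].
exists G => t /andP[lt tm].
have lc : l < c by rewrite /c; lra.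
have wP x : l < x -> [/\ l < w x, w x < x & w x < c].
  move=> lx; rewrite /w; have [? ?] : Num.min x c <= x /\ Num.min x c <= c.
    by rewrite !ge_min !lexx orbT.
  have ? : l < Num.min x c by rewrite lt_min lx.
  by split; lra.
have [lw wt wc] := wP t lt.
have [dF F'] : derivable (F (w t)) t 1 /\ derive1 (F (w t)) t = g t.
  have tu : t < (t + m) / 2 by lra.
  apply: (continuous_FTC1_closed tu) => //.
    by apply: intg => //; lra.
  by apply: gc; rewrite lt.
have FD : is_derive t 1 (fun x => F (w t) x - F (w t) c) (g t).
  have FD : is_derive t 1 (F (w t)) (g t).
    by apply: DeriveDef; [exact: dF|rewrite -derive1E F'].
  apply: (is_derive_eqfun (is_deriveBfun FD (is_derive_cstfun _ _))).
  by rewrite subr0.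
(* For arguments near [t] the moving base point can be frozen at [w t], where the fundamental
   theorem applies. *)
apply: near_eq_is_derive FD => //.
near=> x.
have wx : w t < x by near: x; exact: lt_nbhsr.
have xm : x < m by near: x; exact: lt_nbhsl.
have [? ? ?] := wP x (lt_trans lw wx).
by rewrite /G; exact: FJ.
Unshelve. all: by end_near. Qed.

End Calculus.

(** * The first integral *)

Section ProfileODE.
Context {R : realType}.
Implicit Types (I : set R) (x z th : R -> R) (a kap t s : R).

(* On a curve with [sin th = e^kap x^a], this is [x] as a function of the angle. *)
Definition angle_radius a kap t : R := expR ((ln (sin t) - kap) / a).

Lemma angle_radius_gt0 a kap t : 0 < angle_radius a kap t.
Proof. exact: expR_gt0. Qed.

Lemma is_derive_angle_radius a kap t : 0 < t < pi ->
  is_derive t 1 (angle_radius a kap)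
    (angle_radius a kap t * (cos t / (a * sin t))).
Proof.
move=> /sin_gt0_pi st.
have h : is_derive t 1 (fun t => a^-1 * (ln (sin t) - kap))
    (a^-1 * ((sin t)^-1 * cos t - 0)).
  exact: (is_deriveZfun _ (is_deriveBfun
    (is_derive_compfun (is_derive1_ln st) (is_derive_sin t))
    (is_derive_cstfun _ _))).
have -> : angle_radius a kap = fun t => expR (a^-1 * (ln (sin t) - kap)).
  by apply/funext => u; rewrite /angle_radius mulrC.
apply: (is_derive_eqfun (is_derive_compfun (is_derive_expR _) h)).
by rewrite subr0 invfM; ring.
Qed.

Lemma linear_weingartenP a I x z th s : linear_weingarten a I x z th -> I s ->
  [/\ 0 < x s, is_derive s 1 x (cos (th s)), is_derive s 1 z (sin (th s)) &
      is_derive s 1 th (a * (sin (th s) / x s))].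
Proof.
move=> [[_ _ _ H] K] Is; have [x0 dx dz dth] := H s Is; split => //.
by apply: DeriveDef => //; rewrite -derive1E; exact: K.
Qed.

Lemma first_integral a I x z th : linear_weingarten a I x z th ->
  forall s t, I s -> I t -> sin (th s) * expR (- a * ln (x s)) =
    sin (th t) * expR (- a * ln (x t)).
Proof.
move=> lw; have [[_ _ itvI _] _] := lw.
apply: (derive0_cst itvI) => s Is.
have [x0 dx _ dth] := linear_weingartenP lw Is.
apply: (is_derive_eqfun (is_deriveMfun
  (is_derive_compfun (is_derive_sin _) dth) (is_derive_expln (- a) x0 dx))).
by ring.
Qed.

Lemma sin_cos_angle e f : e ^+ 2 + f ^+ 2 = 1 -> 0 < f ->
  exists t : R, [/\ 0 < t < pi, cos t = e & sin t = f].
Proof.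
move=> ef f0; have e1 : -1 < e < 1.
  by rewrite -ltr_norml -ltr_sqr ?nnegrE// real_normK ?num_real//; nra.
have e1' : -1 <= e <= 1 by move: e1 => /andP[/ltW -> /ltW ->].
exists (acos e); split.
- by move/andP: e1 => [e1 e2]; rewrite acos_gt0 ?acos_ltpi// ?e2 ?e1 ?andbT ltW.
- exact: acosK.
- by rewrite sin_acos// (_ : 1 - _ = f ^+ 2) ?sqrtr_sqr ?gtr0_norm//; lra.
Qed.

(** The points [t1] and [t2] come in either order, so that increasing and decreasing functions are
    treated alike. *)
Lemma preimage_between (D : set R) (G : R -> R) : is_interval D ->
  (forall t, D t -> {for t, continuous G}) ->
  forall t1 t2 y, D t1 -> D t2 -> G t1 <= y <= G t2 -> exists2 t, D t & G t = y.
Proof.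
move=> itvD Gc t1 t2 y D1 D2 /andP[y1 y2].
have sub u v w : D u -> D v -> w \in `[u, v] -> D w.
  by move=> Du Dv; rewrite in_itv => /= ?; exact: itvD Du Dv _ _.
have cont u v : D u -> D v -> {within `[u, v], continuous G}.
  move=> Du Dv; apply: continuous_in_subspaceT => w /[1!inE]/= wuv.
  exact: Gc (sub u v w Du Dv wuv).
have [t12|/ltW t12] := leP t1 t2.
- have [||w /(sub _ _ _ D1 D2) Dw <-] := @IVT _ G t1 t2 y t12; [exact: cont| |by exists w].
  by rewrite ge_min y1 le_max y2 orbT.
- have [||w /(sub _ _ _ D2 D1) Dw <-] := @IVT _ G t2 t1 y t12; [exact: cont| |by exists w].
  by rewrite ge_min y1 le_max y2 orbT.
Qed.

Lemma is_interval_0pi : is_interval [set t : R | 0 < t < pi].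
Proof.
move=> u v /= /andP[u0 _] /andP[_ vpi] w /andP[uw wv].
by rewrite (lt_le_trans u0 uw) (le_lt_trans wv vpi).
Qed.

(** To leave []0, pi[] the angle would have to cross a zero of the sine. *)
Lemma angle_in_0pi I (T : R -> R) s0 : is_interval I ->
  (forall s, I s -> {for s, continuous T}) ->
  (forall s, I s -> 0 < sin (T s)) -> I s0 -> 0 < T s0 < pi ->
  forall s, I s -> 0 < T s < pi.
Proof.
move=> itvI Tc sT I0 /andP[T0 Tpi] s Is.
have H := preimage_between itvI Tc.
apply/andP; split; rewrite ltNge; apply/negP => h.
- have [|u Iu e] := H s s0 0 Is I0; first by rewrite h ltW.
  by have := sT u Iu; rewrite e sin0 ltxx.
- have [|u Iu e] := H s0 s pi I0 Is; first by rewrite h ltW.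
  by have := sT u Iu; rewrite e sinpi ltxx.
Qed.

End ProfileODE.

(** * Parametrization by the angle *)

Section AngleParametrization.
Context {R : realType}.
Implicit Types (I : set R) (x z th T Z : R -> R) (a kap t s : R).

(** Here [eps] is the sign of [sin th0]. The shift [rho] is a multiple of pi, recorded only through
    its effect on sine and cosine, which spares computing the integer quotient. *)
Lemma angle_shift (th0 : R) : sin th0 != 0 ->
  exists eps rho : R, [/\ eps * eps = 1, 0 < th0 - rho < pi,
    forall t, sin (t - rho) = eps * sin t & forall t, cos (t - rho) = eps * cos t].
Proof.
move=> s0; pose eps := Num.sg (sin th0).
have eps2 : eps * eps = 1 by rewrite -expr2 sqr_sg s0.
have [|| t0 [t0pi ct0 st0]] := @sin_cos_angle R (eps * cos th0) (eps * sin th0).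
- by rewrite !exprMn expr2 eps2 !mul1r cos2Dsin2.
- by rewrite -[_ * _]normrEsg normr_gt0.
exists eps, (th0 - t0); rewrite subKr; split => // t.
- rewrite (_ : t - _ = (t - th0) + t0); last by ring.
  rewrite sinD ct0 st0 mulrCA [cos _ * _]mulrCA -mulrDr -sinD.
  by rewrite subrK.
- rewrite (_ : t - _ = (t - th0) + t0); last by ring.
  rewrite cosD ct0 st0 mulrCA [sin _ * _]mulrCA -mulrBr -cosD.
  by rewrite subrK.
Qed.

Lemma is_derive_inverse_incr (D : set R) (G g : R -> R) : is_interval D -> open D ->
  (forall t, D t -> is_derive t 1 G (g t)) -> (forall t, D t -> 0 < g t) ->
  exists H, forall t, D t -> H (G t) = t /\ is_derive (G t) 1 H (g t)^-1.
Proof.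
move=> itvD oD dG g0.
have inj u v : D u -> D v -> G u = G v -> u = v.
  have incr := derive_gt0_incr itvD dG g0.
  move=> Du Dv e; have [uv|vu|//] := ltgtP u v.
    by have := incr u v Du Dv uv; rewrite e ltxx.
  by have := incr v u Dv Du vu; rewrite e ltxx.
pose H y := get [set t | D t /\ G t = y].
have GK t : D t -> H (G t) = t.
  move=> Dt; have [] : [set u | D u /\ G u = G t] (H (G t)).
    by apply: getPex; exists t.
  by move=> DH; exact: inj.
exists H => t Dt; split; first exact: GK.
have nD : \forall u \near t, D u by exact: open_nbhs_nbhs.
apply: is_derive_inverse (dG t Dt) _; last by rewrite gt_eqF ?g0.
- by near=> u; apply: GK; near: u.
- by near=> u; apply: is_derive_continuous (dG u _); near: u.
Unshelve. all: by end_near. Qed.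

Lemma open_0pi : open [set t : R | 0 < t < pi].
Proof.
rewrite (_ : [set _ | _] = `]0, pi[%classic); first exact: interval_open.
by rewrite set_itvE.
Qed.

(** The affine map serves two uses: the parameter domain of the extended solution, where [b] may
    have either sign, and the range of a decreasing function, with [b = -1]. *)
Lemma open_affine_preimage_incr_image (D : set R) (G : R -> R) (b k : R) :
  is_interval D -> open D ->
  (forall t, D t -> {for t, continuous G}) ->
  (forall s t, D s -> D t -> s < t -> G s < G t) ->
  open [set s | exists2 t, D t & G t = b * s + k].
Proof.
move=> itvD oD Gc incr; rewrite openE => s [t Dt Gt].
have /nbhs_ballP[e /= e0 eD] : nbhs t D by exact: open_nbhs_nbhs.
have Dl : D (t - e / 2).
  by apply: eD; rewrite /ball/= opprB addrC subrK gtr0_norm; lra.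
have Dr : D (t + e / 2).
  by apply: eD; rewrite /ball/= opprD addrA subrr sub0r normrN gtr0_norm; lra.
have Gl : G (t - e / 2) < b * s + k by rewrite -Gt incr//; lra.
have Gr : b * s + k < G (t + e / 2) by rewrite -Gt incr//; lra.
have cont : {for s, continuous (fun s => b * s + k)}.
  exact: is_derive_continuous (is_deriveDfun (is_deriveZfun b (is_derive_id s 1))
    (is_derive_cstfun k s)).
rewrite /interior; near=> u; apply: (preimage_between itvD Gc Dl Dr).
by apply/andP; split; apply: ltW; near: u;
  [exact: cvgr_gt cont _ Gl|exact: cvgr_lt cont _ Gr].
Unshelve. all: by end_near. Qed.

(** The angle satisfies the autonomous equation [T' = a eps sin T / X T], so a primitive [G] of
    [X / sin] linearizes it: [G (T s) = b s + c]. The last conclusion allows any primitive [Z],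
    because for [a > 0] one defined beyond [0] and [pi] will be chosen. *)
Lemma angle_ode_maximal a kap I x z th eps rho : a != 0 -> eps * eps = 1 ->
  maximal_linear_weingarten a I x z th ->
  (forall t, sin (t - rho) = eps * sin t) ->
  (forall t, cos (t - rho) = eps * cos t) ->
  (forall s, I s -> 0 < th s - rho < pi) ->
  (forall s, I s -> x s = angle_radius a kap (th s - rho)) ->
  let T s := th s - rho in
  [/\ forall t, 0 < t < pi -> exists2 s, I s & T s = t,
      (forall s u, I s -> I u -> s < u -> T s < T u) \/
      (forall s u, I s -> I u -> s < u -> T u < T s) &
      forall Z, (forall t, 0 < t < pi -> is_derive t 1 Z (angle_radius a kap t / a)) ->
        exists k, forall s, I s -> z s = Z (T s) + k].
Proof.
move=> a0 eps2 [lw mx] sinrho cosrho Tpi xT S; rewrite {}/S.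
have [[[s0 I0] oI itvI _] _] := lw.
pose X := angle_radius a kap.
have X0 t : 0 < X t := angle_radius_gt0 a kap t.
have sinT s : sin (th s) = eps * sin (th s - rho) by rewrite sinrho mulrA eps2 mul1r.
have dT s : I s -> is_derive s 1 (fun s => th s - rho)
    (a * eps * (sin (th s - rho) / X (th s - rho))).
  move=> Is; have [_ _ _ dth] := linear_weingartenP lw Is.
  apply: (is_derive_eqfun (is_deriveBfun dth (is_derive_cstfun rho s))).
  by rewrite subr0 sinT xT// -/X; ring.
have ZT Z : (forall t, 0 < t < pi -> is_derive t 1 Z (X t / a)) ->
    exists k, forall s, I s -> z s = Z (th s - rho) + k.
  move=> dZ; exists (z s0 - Z (th s0 - rho)) => s Is.
  suff : z s - Z (th s - rho) = z s0 - Z (th s0 - rho) by move=> <-; ring.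
  apply: (derive0_cst (f := fun s => z s - Z (th s - rho)) itvI) => // u Iu.
  have [_ _ dz _] := linear_weingartenP lw Iu.
  apply: (is_derive_eqfun (is_deriveBfun dz
    (is_derive_compfun (g := fun s => th s - rho) (dZ _ (Tpi u Iu)) (dT u Iu)))).
  have := gt_eqF (X0 (th u - rho)); rewrite sinT => h.
  by field; rewrite a0 h.
have cX t : 0 < t < pi -> {for t, continuous X}.
  by move=> /(is_derive_angle_radius a kap)/is_derive_continuous.
have sn0 (t : R) : 0 < t < pi -> sin t != 0.
  by move=> /sin_gt0_pi st; rewrite gt_eqF.
have [G dG] : exists G : R -> R, forall t, 0 < t < pi -> is_derive t 1 G (X t / sin t).
  apply: antiderivative; first exact: pi_gt0.
  move=> t tpi; apply: continuousM; first exact: cX.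
  by apply: continuousV; [exact: sn0|exact: continuous_sin].
have g0 t : 0 < t < pi -> 0 < X t / sin t.
  by move=> /sin_gt0_pi st; rewrite divr_gt0.
have Gincr := derive_gt0_incr is_interval_0pi dG g0.
have cG t : 0 < t < pi -> {for t, continuous G}.
  by move=> /dG/is_derive_continuous.
have [H HG] := is_derive_inverse_incr is_interval_0pi open_0pi dG g0.
have [Z dZ] : exists Z : R -> R, forall t, 0 < t < pi -> is_derive t 1 Z (X t / a).
  apply: antiderivative; first exact: pi_gt0.
  by move=> t tpi; apply: continuousM; [exact: cX|exact: cst_continuous].
have [k zZ] := ZT Z dZ.
(* The sign of [a] and the orientation are both put into [b], so that [G] itself is always
   increasing. *)
pose b := a * eps.
pose c := G (th s0 - rho) - b * s0.
have GT s : I s -> G (th s - rho) = b * s + c.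
  move=> Is; suff : G (th s - rho) - b * s = G (th s0 - rho) - b * s0.
    by rewrite /c => <-; ring.
  apply: (derive0_cst (f := fun s => G (th s - rho) - b * s) itvI) => // u Iu.
  apply: (is_derive_eqfun (is_deriveBfun
    (is_derive_compfun (g := fun s => th s - rho) (dG _ (Tpi u Iu)) (dT u Iu))
    (is_deriveZfun b (is_derive_id u 1)))).
  have := gt_eqF (X0 (th u - rho)) => h.
  by rewrite /b; field; rewrite sn0 ?h//; exact: Tpi.
(* The parameters at which the inverted equation makes sense; over them the angle sweeps all of []0,
   pi[]. *)
pose J := [set s | exists2 t, 0 < t < pi & G t = b * s + c].
have IJ : I `<=` J by move=> s Is; exists (th s - rho); [exact: Tpi|exact: GT].
pose T1 s := H (b * s + c).
have T1K s t : 0 < t < pi -> G t = b * s + c -> T1 s = t.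
  by move=> /HG[GK _] e; rewrite /T1 -e.
have dT1 s t : 0 < t < pi -> G t = b * s + c -> is_derive s 1 T1 (b * (sin t / X t)).
  move=> tpi e; have [_ dH] := HG t tpi; rewrite e in dH.
  apply: (is_derive_eqfun (is_derive_compfun (g := fun s => b * s + c) dH (is_deriveDfun
    (is_deriveZfun b (is_derive_id s 1)) (is_derive_cstfun c s)))).
  by rewrite invf_div; ring.
have rhoK t : [/\ sin (t + rho) = eps * sin t & cos (t + rho) = eps * cos t].
  have h := addrK rho t.
  by split; rewrite -[in RHS]h ?sinrho ?cosrho mulrA eps2 mul1r.
have lwJ : linear_weingarten a J (fun s => X (T1 s)) (fun s => Z (T1 s) + k)
    (fun s => T1 s + rho).
  have D s : J s -> [/\ is_derive s 1 (fun s => X (T1 s)) (cos (T1 s + rho)),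
      is_derive s 1 (fun s => Z (T1 s) + k) (sin (T1 s + rho)) &
      is_derive s 1 (fun s => T1 s + rho) (a * (sin (T1 s + rho) / X (T1 s)))].
    case=> t tpi e; have T1t := T1K s t tpi e; have dT1t := dT1 s t tpi e.
    have h := gt_eqF (X0 t); have h' := sn0 t tpi.
    have Tpi1 : 0 < T1 s < pi by rewrite T1t.
    have [-> ->] := rhoK (T1 s); split.
    - have dX := is_derive_angle_radius a kap Tpi1.
      apply: (is_derive_eqfun (is_derive_compfun dX dT1t)).
      by rewrite T1t -/X /b; field; rewrite a0 h'/= h.
    - apply: (is_derive_eqfun (is_deriveDfun
        (is_derive_compfun (dZ _ Tpi1) dT1t) (is_derive_cstfun k s))).
      by rewrite T1t /b; field; rewrite a0 h.
    - apply: (is_derive_eqfun (is_deriveDfun dT1t (is_derive_cstfun rho s))).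
      by rewrite T1t /b; ring.
  split; last first.
    by move=> s /D[_ _ dth]; rewrite /kappa1 derive1E; exact: derive_val.
  split; first by exists s0; exact: IJ.
  - exact: open_affine_preimage_incr_image is_interval_0pi open_0pi cG Gincr.
  - move=> s1 s2 [t1 t1pi e1] [t2 t2pi e2] s /andP[s1s ss2].
    have [b0|b0] := leP 0 b.
    + apply: (preimage_between is_interval_0pi cG t1pi t2pi).
      by rewrite e1 e2 !lerD2r !ler_wpM2l.
    + apply: (preimage_between is_interval_0pi cG t2pi t1pi).
      by rewrite e1 e2 !lerD2r (ler_nM2l b0) (ler_nM2l b0) ss2 s1s.
  - move=> s Js; have [? ? dth] := D s Js; split => //.
have JI : J `<=` I.
  apply: mx lwJ IJ _ => s Is /=.
  have e : T1 s = th s - rho by apply: T1K; [exact: Tpi|exact: GT].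
  by rewrite e subrK zZ// xT.
have b0 : b != 0.
  rewrite /b mulf_neq0//; apply/eqP => e0.
  by move: eps2; rewrite e0 mul0r => /esym/eqP; rewrite oner_eq0.
have Tmono s u : I s -> I u -> b * s < b * u -> th s - rho < th u - rho.
  move=> Is Iu bsu; rewrite ltNge; apply/negP; rewrite le_eqVlt => /predU1P[e|h].
    by have := bsu; have := GT u Iu; rewrite e GT// => /addIr ->; rewrite ltxx.
  have := Gincr _ _ (Tpi u Iu) (Tpi s Is) h.
  by rewrite !GT// ltrD2r ltNge (ltW bsu).
split => //.
- move=> t tpi; have Js : J ((G t - c) / b).
    by exists t => //; rewrite mulrC divfK// subrK.
  have Is := JI _ Js; exists ((G t - c) / b) => //.
  rewrite -(T1K _ _ (Tpi _ Is) (GT _ Is)); apply: T1K => //.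
  by rewrite mulrC divfK// subrK.
- have [b0'|b0'] := ltP 0 b; [left|right] => s u Is Iu su; apply: Tmono => //.
    by rewrite (ltr_pM2l b0').
  by rewrite ltr_nM2l// lt_neqAle b0 b0'.
Qed.

End AngleParametrization.

(** * Surfaces of revolution and ovaloids *)

Section Revolution.
Context {R : realType}.
Local Notation R3 := (R * R * R)%type.
Implicit Types (f g : R -> R) (p q t w : R) (P Q : R3).

Lemma polar_coordinates (X Y r : R) : 0 <= r -> X ^+ 2 + Y ^+ 2 = r ^+ 2 ->
  exists phi : R, X = r * cos phi /\ Y = r * sin phi.
Proof.
rewrite le_eqVlt => /predU1P[<-|r0] e.
  have [X2 Y2] : X ^+ 2 = 0 /\ Y ^+ 2 = 0.
    by have := sqr_ge0 X; have := sqr_ge0 Y; split; nra.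
  exists 0; move/eqP: X2; move/eqP: Y2; rewrite !sqrf_eq0 => /eqP -> /eqP ->.
  by rewrite !mul0r.
have rn0 : r != 0 by rewrite gt_eqF.
have e1 : (X / r) ^+ 2 + (Y / r) ^+ 2 = 1.
  by rewrite !expr_div_n -mulrDl e divff// sqrf_eq0.
have rK (u : R) : u = r * (u / r) by rewrite mulrC divfK.
(* [sin_cos_angle] only provides angles with positive sine; a negative [Y] is reflected, and [Y = 0]
   gives the angle [0] or [pi]. *)
have [Y0|Y0|Y0] := ltgtP Y 0.
- have [||t [_ ct st]] := @sin_cos_angle R (X / r) (- (Y / r)).
  + by rewrite sqrrN.
  + by rewrite oppr_gt0 ltr_pdivrMr// mul0r.
  by exists (- t); rewrite cosN sinN ct st opprK -!rK.
- have [||t [_ ct st]] := @sin_cos_angle R (X / r) (Y / r) => //.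
  + by rewrite divr_gt0.
  by exists t; rewrite ct st -!rK.
- move: e; rewrite Y0 expr0n addr0 => /eqP; rewrite eqf_sqr => /orP[] /eqP ->.
  + by exists 0; rewrite cos0 sin0 mulr1 mulr0.
  + by exists pi; rewrite cospi sinpi mulrN1 mulr0.
Qed.

(** Eliminates the rotation angle in favour of an equation, the form suited to topology and
    convexity. *)
Lemma surface_of_revolution_zgraph (J : set R) f : (forall t, J t -> 0 <= f t) ->
  surface_of_revolution (zgraph J f) =
  [set P | J P.2 /\ P.1.1 ^+ 2 + P.1.2 ^+ 2 = f P.2 ^+ 2].
Proof.
move=> f0; apply/seteqP; split.
- move=> P /= [Q [t Jt <-] [phi ->]] /=; split => //.
  by rewrite !exprMn -mulrDr cos2Dsin2 mulr1.
- move=> [[X Y] Z] /= [JZ e].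
  have [phi [-> ->]] := polar_coordinates (f0 _ JZ) e.
  by exists (f Z, Z); [exists Z|exists phi].
Qed.

Lemma continuous_R3_11 : continuous (fun P : R3 => P.1.1).
Proof. by move=> P; apply: (@continuous_comp _ _ _ fst fst); exact: cvg_fst. Qed.

Lemma continuous_R3_12 : continuous (fun P : R3 => P.1.2).
Proof. by move=> P; apply: (@continuous_comp _ _ _ fst snd); [exact: cvg_fst|exact: cvg_snd]. Qed.

Lemma continuous_R3_2 : continuous (fun P : R3 => P.2).
Proof. by move=> P; exact: cvg_snd. Qed.

Definition revolved p q f : set R3 :=
  [set P | p <= P.2 <= q /\ P.1.1 ^+ 2 + P.1.2 ^+ 2 = f P.2 ^+ 2].

Let radial_defect f P := P.1.1 ^+ 2 + P.1.2 ^+ 2 - f P.2 ^+ 2.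

Let radial_defect_continuous f : continuous f -> continuous (radial_defect f).
Proof.
move=> cf P; apply: cvgB; [apply: cvgD|]; rewrite ?expr2.
- by apply: cvgM; exact: continuous_R3_11.
- by apply: cvgM; exact: continuous_R3_12.
- by apply: cvgM; apply: (@continuous_comp _ _ _ (fun P : R3 => P.2) f);
    do ?[exact: continuous_R3_2|exact: cf].
Qed.

(** * The convex body bounded by a revolved concave profile *)

Section Body.
Variables (p q : R) (f : R -> R).
Hypothesis pq : p < q.
Hypothesis cf : continuous f.
Hypothesis fp : forall t, t <= p -> f t = 0.
Hypothesis fq : forall t, q <= t -> f t = 0.
Hypothesis f_gt0 : forall t, p < t < q -> 0 < f t.
Hypothesis conc : forall x y l, p <= x <= q -> p <= y <= q -> 0 <= l <= 1 ->
  l * f x + (1 - l) * f y <= f (l * x + (1 - l) * y).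

Let f_ge0 t : 0 <= f t.
Proof.
have [/fp->//|pt] := leP t p; have [/fq->//|tq] := leP q t.
by rewrite ltW// f_gt0// pt.
Qed.

Let body := [set P : R3 | p <= P.2 <= q /\ P.1.1 ^+ 2 + P.1.2 ^+ 2 <= f P.2 ^+ 2].
Local Notation bdry := (revolved p q f).

Let closed_body : closed body.
Proof.
have -> : body = (fun P => P.2) @^-1` `[p, q] `&` radial_defect f @^-1` [set u | u <= 0].
  apply/seteqP; split => P; rewrite /body /radial_defect/= in_itv/= subr_le0 => -[] //.
apply: closedI; apply: closed_comp.
- by move=> P _; exact: continuous_R3_2.
- exact: interval_closed.
- by move=> P _; exact: radial_defect_continuous.
- exact: closed_le.
Qed.

Let compact_body : compact body.
Proof.
have [c _ fc] := EVT_max (ltW pq) (continuous_subspaceT cf).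
have cpt : compact ((`[- f c, f c] `*` `[- f c, f c]) `*` `[p, q] : set R3).
  by apply: compact_setX; [apply: compact_setX|]; exact: segment_compact.
apply: (subclosed_compact closed_body cpt) => -[[X Y] Z] [/= Zpq XY].
have fZ : f Z <= f c by apply: fc; rewrite in_itv.
have f0 := f_ge0 Z; have fc0 := f_ge0 c.
have X2 := sqr_ge0 X; have Y2 := sqr_ge0 Y.
have XYc : X ^+ 2 + Y ^+ 2 <= f c ^+ 2 by apply: (le_trans XY); rewrite lerXn2r// nnegrE.
rewrite !in_itv/= Zpq -!ler_norml; split => //; split;
  by rewrite -ler_sqr ?nnegrE// real_normK ?num_real//; lra.
Qed.

(** The strict inequality is an open condition on all of space and already forces [p < P.2 < q],
    because [f] vanishes elsewhere. Conversely, a point where equality holds leaves the body under a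
    small horizontal move. *)
Let interior_body : body° = [set P | P.1.1 ^+ 2 + P.1.2 ^+ 2 < f P.2 ^+ 2].
Proof.
apply/seteqP; split => -[[X Y] Z].
- move=> /[dup] /interior_subset[/= Zpq XY] /nbhs_ballP[e /= e0 eb].
  rewrite lt_neqAle XY andbT; apply/eqP => E.
  (* The displacement takes the sign of [X], so that the move goes away from the axis and the
     squared radius really grows. *)
  pose s : R := if 0 <= X then e / 2 else - (e / 2).
  have sX : 0 <= s * X.
    rewrite /s; have [X0|X0] := leP 0 X.
      by rewrite mulr_ge0// divr_ge0// ltW.
    by rewrite mulNr oppr_ge0 mulr_ge0_le0// ltW// divr_gt0.
  have s2 : s ^+ 2 = (e / 2) ^+ 2 by rewrite /s; case: ifP => // _; rewrite sqrrN.
  have se : `|s| = e / 2 by rewrite /s; case: ifP => _; rewrite ?normrN gtr0_norm// divr_gt0.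
  have /eb[/= _] : ball ((X, Y), Z) e ((X + s, Y), Z).
    split; [split|] => /=; [|exact: ballxx|exact: ballxx].
    by rewrite /ball/= opprD addrA subrr sub0r normrN se ltr_pdivrMr// ltr_pMr// ltr1n.
  have e2 : 0 < (e / 2) ^+ 2 by rewrite exprn_gt0// divr_gt0.
  by rewrite -E sqrrD -s2 in e2 *; lra.
- have -> : [set P : R3 | P.1.1 ^+ 2 + P.1.2 ^+ 2 < f P.2 ^+ 2] =
      radial_defect f @^-1` [set u | u < 0].
    by apply/seteqP; split => P /=; rewrite /radial_defect subr_lt0.
  move: {X Y Z}(X, Y, Z); rewrite -/(subset _ _) -open_subsetE; last first.
    by apply: open_comp; [move=> P _; exact: radial_defect_continuous|exact: open_lt].
  move=> P /=; rewrite /radial_defect subr_lt0 => XY.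
  have f0 : 0 < f P.2.
    rewrite lt_neqAle f_ge0 andbT; apply: contraTneq XY => <-.
    by rewrite -leNgt expr0n addr_ge0 ?sqr_ge0.
  split; last exact: ltW.
  apply/andP; split; rewrite leNgt; apply/negP => /ltW h; move: f0.
    by rewrite fp// ltxx.
  by rewrite fq// ltxx.
Qed.

Let convex_body : convex_set body.
Proof.
move=> [[X1 Y1] Z1] [[X2 Y2] Z2] l; rewrite !inE => -[/= Z1pq XY1] [/= Z2pq XY2].
have l01 : 0 <= l%:num <= 1 by rewrite ge0 le1.
have FF := conc Z1pq Z2pq l01.
suff : body ((l%:num * X1 + (1 - l%:num) * X2, l%:num * Y1 + (1 - l%:num) * Y2),
    l%:num * Z1 + (1 - l%:num) * Z2) by exact.
move: l01 FF; move: l%:num => m /andP[m0 m1]; rewrite /body/=.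
have := f_ge0 Z1; have := f_ge0 Z2; have := f_ge0 (m * Z1 + (1 - m) * Z2).
set F1 := f Z1 in XY1 *; set F2 := f Z2 in XY2 *; set F := f _ => F0 F20 F10 FF.
split.
  by move: Z1pq Z2pq => /andP[? ?] /andP[? ?]; apply/andP; split; nra.
apply: (@le_trans _ _ ((m * F1 + (1 - m) * F2) ^+ 2)); last first.
  by rewrite lerXn2r// nnegrE// addr_ge0// mulr_ge0//; lra.
(* Cauchy-Schwarz for the horizontal parts; it controls the cross term when the squared norm of the
   convex combination is expanded. *)
have CS : X1 * X2 + Y1 * Y2 <= F1 * F2.
  apply: le_trans (ler_norm _) _; rewrite -ler_sqr ?nnegrE ?mulr_ge0// real_normK ?num_real//.
  apply: (@le_trans _ _ ((X1 ^+ 2 + Y1 ^+ 2) * (X2 ^+ 2 + Y2 ^+ 2))).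
    by have := sqr_ge0 (X1 * Y2 - X2 * Y1); nra.
  by rewrite exprMn ler_pM// addr_ge0// sqr_ge0.
have h1 : 0 <= m * (1 - m) by rewrite mulr_ge0//; lra.
have h2 : 0 <= m ^+ 2 := sqr_ge0 m.
have h3 : 0 <= (1 - m) ^+ 2 := sqr_ge0 _.
have := ler_wpM2l h1 CS; have := ler_wpM2l h2 XY1; have := ler_wpM2l h3 XY2.
by rewrite !expr2; nra.
Qed.

Lemma convex_surface_revolved : convex_surface bdry.
Proof.
exists body; split => //.
- exists ((0, 0), (p + q) / 2); rewrite interior_body/= expr0n addr0.
  by rewrite exprn_gt0// f_gt0// !midf_lt.
- rewrite -(closure_id _).1// interior_body; apply/seteqP; split => P.
    by move=> [Ppq e]; split; [split; rewrite ?e|rewrite /= e ltxx].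
  by move=> [[Ppq e]] /negP; rewrite -leNgt => e'; split => //; apply/eqP; rewrite eq_le e.
Qed.

Lemma revolved_zaxis : bdry `&` zaxis = [set ((0, 0), p); ((0, 0), q)].
Proof.
apply/seteqP; split => -[[X Y] Z].
- move=> [[/= /andP[pZ Zq] e] [X0 Y0]]; move: e; rewrite X0 Y0 expr0n addr0 => /esym/eqP.
  rewrite sqrf_eq0 => /eqP fZ.
  move: pZ; rewrite le_eqVlt => /predU1P[<-|pZ]; first by left.
  move: Zq; rewrite le_eqVlt => /predU1P[->|Zq]; first by right.
  by have := @f_gt0 Z; rewrite fZ ltxx pZ => /(_ Zq).
- have [le fp0 fq0] := And3 (ltW pq) (fp (lexx p)) (fq (lexx q)).
  by case=> [[-> -> ->]|[-> -> ->]]; do !split => //=;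
    rewrite ?lexx ?le ?fp0 ?fq0// ?expr0n ?addr0.
Qed.

(** A profile that outgrows every multiple of [|t - c|] is steeper than any cone at the pole, so
    height varies there much less than horizontal distance. *)
Lemma revolved_tangent c : f c = 0 ->
  (forall M, \forall t \near c, p <= t <= q -> M * `|t - c| <= f t) ->
  tangent_normal bdry ((0, 0), c) ((0, 0), 1).
Proof.
(* With [N] the maximum norm of [Q - P], on the surface [f Z <= 2 N]; the slope [2 / e] turns this
   into [|Z - c| <= e N]. *)
move=> fc tang e e0; have T := tang (2 / e).
rewrite near_withinE.
have H : \forall P \near nbhs (((0, 0), c) : R3),
    p <= P.2 <= q -> 2 / e * `|P.2 - c| <= f P.2.
  exact: (@continuous_R3_2 ((0, 0), c) _ T).
apply: filterS H => -[[X Y] Z] /= h [/= Zpq E].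
rewrite /dot3 /= !mul0r !add0r mul1r.
have {}h := h Zpq.
rewrite !prod_normE /= !subr0.
set N := Num.max _ _.
have [NX NY] : `|X| <= N /\ `|Y| <= N by rewrite /N !le_max !lexx ?orbT.
have fN : f Z <= 2 * N.
  rewrite -ler_sqr ?nnegrE//; last by have := normr_ge0 X; lra.
  rewrite -E -(real_normK (num_real X)) -(real_normK (num_real Y)).
  by have := normr_ge0 X; have := normr_ge0 Y; nra.
have : 2 / e * `|Z - c| <= 2 * N by exact: le_trans fN.
by rewrite -mulrA ler_pM2l// mulrC ler_pdivrMr// mulrC.
Qed.

End Body.

(** * Homeomorphisms that rescale the radius at each height *)

Section Homeomorphism.
Variables (p q p' q' : R) (f g l l' : R -> R).
Hypotheses (cf : continuous f) (cg : continuous g).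
Hypotheses (cl : continuous l) (cl' : continuous l').
Hypotheses (lK : cancel l l') (lK' : cancel l' l).
Hypothesis lpq : forall t, (p <= t <= q) = (p' <= l t <= q').
Hypothesis f_ge0 : forall t, p <= t <= q -> 0 <= f t.
Hypothesis g_ge0 : forall t, p' <= t <= q' -> 0 <= g t.
Hypothesis fg0 : forall t, p <= t <= q -> (f t == 0) = (g (l t) == 0).

(* Where [f] vanishes the quotient is the junk value [0], which is the right
   value there because [P.1 = 0] at such points of [revolved p q f]. *)
Let rescale P : R3 :=
  ((P.1.1 * (g (l P.2) / f P.2), P.1.2 * (g (l P.2) / f P.2)), l P.2).

(** [c] stands for either horizontal coordinate. Where [f] vanishes the quotient need not be
    continuous, but [|c Q| <= f Q.2] bounds the product by [g (l Q.2)], which tends to [0], and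
    squeezing applies. *)
Let rescale_coord (c : R3 -> R) P : continuous c ->
  (forall P, revolved p q f P -> `|c P| <= f P.2) -> revolved p q f P ->
  c Q * (g (l Q.2) / f Q.2) @[Q --> within (revolved p q f) (nbhs P)] -->
  c P * (g (l P.2) / f P.2).
Proof.
move=> cc cle SP; have [Ppq _] := SP.
have cgl : g (l Q.2) @[Q --> P] --> g (l P.2).
  apply: (@continuous_comp _ _ _ (fun Q : R3 => l Q.2) g); last exact: cg.
  apply: (@continuous_comp _ _ _ (fun Q : R3 => Q.2) l); last exact: cl.
  exact: continuous_R3_2.
have cfz : f Q.2 @[Q --> P] --> f P.2.
  apply: (@continuous_comp _ _ _ (fun Q : R3 => Q.2) f); last exact: cf.
  exact: continuous_R3_2.
have [f0|f0] := eqVneq (f P.2) 0; last first.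
  by apply: cvg_within_filter; apply: cvgM; [exact: cc|apply: cvgM => //; exact: cvgV].
have g0 : g (l P.2) = 0 by apply/eqP; rewrite -fg0// f0.
rewrite g0 mul0r mulr0; rewrite g0 in cgl.
have cgl' : g (l Q.2) @[Q --> within (revolved p q f) (nbhs P)] --> 0.
  exact: cvg_within_filter cgl.
apply: (@squeeze_cvgr _ _ _ _ (fun Q => - g (l Q.2)) (fun Q => g (l Q.2))) => //.
- rewrite near_withinE; apply: nearW => Q SQ; have [Qpq _] := SQ.
  have gQ : 0 <= g (l Q.2) by rewrite g_ge0// -lpq.
  have fQ := f_ge0 Qpq.
  rewrite -ler_norml normrM (ger0_norm (divr_ge0 gQ fQ)).
  have [->|fQ0] := eqVneq (f Q.2) 0; first by rewrite invr0 !mulr0.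
  have fQ1 : 0 < f Q.2 by rewrite lt_neqAle eq_sym fQ0.
  by rewrite mulrCA ler_piMr// ler_pdivrMr// mul1r cle.
- have h := cvgN cgl'; rewrite oppr0 in h; exact: h.
Qed.

Let normr_le_radius P : revolved p q f P -> `|P.1.1| <= f P.2 /\ `|P.1.2| <= f P.2.
Proof.
move=> [/f_ge0 f0 e]; have := sqr_ge0 P.1.1; have := sqr_ge0 P.1.2 => h1 h2.
by split; rewrite -ler_sqr ?nnegrE// real_normK ?num_real// -e; lra.
Qed.

Lemma rescale_continuous : {within revolved p q f, continuous rescale}.
Proof.
apply/subspace_continuousP => P SP.
have h1 := rescale_coord continuous_R3_11 (fun Q SQ => proj1 (normr_le_radius SQ)) SP.
have h2 := rescale_coord continuous_R3_12 (fun Q SQ => proj2 (normr_le_radius SQ)) SP.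
have h3 : l Q.2 @[Q --> within (revolved p q f) (nbhs P)] --> l P.2.
  apply: cvg_within_filter.
  apply: (@continuous_comp _ _ _ (fun Q : R3 => Q.2) l); last exact: cl.
  exact: continuous_R3_2.
exact: (cvg_pair (cvg_pair h1 h2) h3).
Qed.

Lemma rescale_revolved P : revolved p q f P -> revolved p' q' g (rescale P).
Proof.
move=> [Ppq e]; split => /=; first by rewrite -lpq.
rewrite !exprMn -mulrDl e -!exprMn; congr (_ ^+ 2).
have [f0|f0] := eqVneq (f P.2) 0; last by rewrite mulrC divfK.
by rewrite f0 mul0r; apply/esym/eqP; rewrite -fg0// f0.
Qed.

Lemma rescaleK P : revolved p q f P ->
  (((rescale P).1.1 * (f (l' (rescale P).2) / g (rescale P).2),
    (rescale P).1.2 * (f (l' (rescale P).2) / g (rescale P).2)),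
   l' (rescale P).2) = P.
Proof.
move=> SP; have [Ppq e] := SP; have [] := normr_le_radius SP.
case: P SP Ppq e => [[X Y] Z] _ /= Zpq e; rewrite lK.
have [f0|f0] := eqVneq (f Z) 0.
  by rewrite f0 !normr_le0 => /eqP -> /eqP ->; rewrite !mul0r.
have g0 : g (l Z) != 0 by rewrite -fg0.
move=> _ _; congr ((_, _), _); by field; rewrite f0 g0.
Qed.

End Homeomorphism.

(** The hypotheses are symmetric in the two surfaces, so the inverse is the same rescaling with the
    roles exchanged. *)
Lemma homeomorphic_revolved p q p' q' f g l l' :
  continuous f -> continuous g -> continuous l -> continuous l' ->
  cancel l l' -> cancel l' l ->
  (forall t, (p <= t <= q) = (p' <= l t <= q')) ->
  (forall t, p <= t <= q -> 0 <= f t) -> (forall t, p' <= t <= q' -> 0 <= g t) ->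
  (forall t, p <= t <= q -> (f t == 0) = (g (l t) == 0)) ->
  homeomorphic (revolved p q f) (revolved p' q' g).
Proof.
move=> cf cg cl cl' lK lK' lpq f0 g0 fg0.
have lpq' t : (p' <= t <= q') = (p <= l' t <= q) by rewrite lpq lK'.
have fg0' t : p' <= t <= q' -> (g t == 0) = (f (l' t) == 0).
  by rewrite lpq' => /fg0 ->; rewrite lK'.
eexists; eexists; split.
- exact: (@rescale_continuous p q p' q' f g l cf cg cl lpq f0 g0 fg0).
- exact: (@rescale_continuous p' q' p q g f l' cg cf cl' lpq' g0 f0 fg0').
- move=> P SP; split; first exact: (rescale_revolved lpq fg0).
  exact: (@rescaleK p q f g l l' lK f0 fg0).
- move=> P SP; split; first exact: (rescale_revolved lpq' fg0').
  exact: (@rescaleK p' q' g f l' l lK' g0 fg0').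
Qed.

Lemma round_sphere_revolved :
  round_sphere 0 1 = revolved (-1) 1 (fun t => Num.sqrt (1 - t ^+ 2)).
Proof.
apply/seteqP; split => -[[X Y] Z]; rewrite /round_sphere /dot3 /= !subr0 expr1n -!expr2.
- have := sqr_ge0 X; have := sqr_ge0 Y => Y2 X2 e.
  have Z1 : Z ^+ 2 <= 1 by lra.
  split => /=; last by rewrite sqr_sqrtr; lra.
  by rewrite -ler_norml -ler_sqr ?nnegrE// real_normK ?num_real// expr1n.
- move=> [/= Z1]; rewrite sqr_sqrtr; first by move=> ->; ring.
  by rewrite subr_ge0 -(real_normK (num_real Z)) expr_le1 ?ler_norml.
Qed.

Lemma closed_genus0_revolved p q f : p < q -> continuous f ->
  (forall t, t <= p -> f t = 0) -> (forall t, q <= t -> f t = 0) ->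
  (forall t, p < t < q -> 0 < f t) -> closed_genus0 (revolved p q f).
Proof.
move=> pq cf fp fq f0; rewrite /closed_genus0 round_sphere_revolved.
pose d := (q - p) / 2; pose m := (p + q) / 2.
have d0 : 0 < d by rewrite divr_gt0// subr_gt0.
have dn0 : d != 0 by rewrite gt_eqF.
have lpq t : (-1 <= t <= 1) = (p <= d * t + m <= q).
  have -> : p = d * -1 + m by rewrite /d /m; field.
  have -> : q = d * 1 + m by rewrite /d /m; field.
  by rewrite !lerD2r !(ler_pM2l d0).
have aff (u v : R) : continuous (fun t => u * t + v).
  move=> t; exact: is_derive_continuous (is_deriveDfun
    (is_deriveZfun u (is_derive_id t 1)) (is_derive_cstfun v t)).
have fge0 t : p <= t <= q -> 0 <= f t.
  move=> _; have [/fp->//|pt] := leP t p; have [/fq->//|tq] := leP q t.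
  by rewrite ltW// f0// pt.
apply: (@homeomorphic_revolved _ _ _ _ _ _ (fun t => d * t + m)
  (fun t => d^-1 * t + - (d^-1 * m))) => //.
- move=> t; apply: (@continuous_comp _ _ _ (fun t : R => 1 - t ^+ 2) Num.sqrt).
    by apply: cvgB; [exact: cvg_cst|exact: exprn_continuous].
  exact: sqrt_continuous.
- by move=> t; rewrite mulrDr mulrA mulVf// mul1r addrK.
- by move=> t; field.
- move=> t t1; rewrite sqrtr_eq0 subr_le0.
  have [|t1'] := boolP (-1 < t < 1).
    move=> t1'; have -> : (f (d * t + m) == 0) = false.
      rewrite gt_eqF// f0//; move: t1'.
      have -> : p = d * -1 + m by rewrite /d /m; field.
      have -> : q = d * 1 + m by rewrite /d /m; field.
      by rewrite !ltrD2r !(ltr_pM2l d0).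
    apply/negbTE; rewrite -ltNge -(real_normK (num_real t)) expr_lt1//.
    by rewrite ltr_norml.
  have [->|->] : t = -1 \/ t = 1.
    move: t1 t1' => /andP[]; rewrite le_eqVlt => /predU1P[<-|->]; first by left.
    by rewrite le_eqVlt => /predU1P[->|->//]; right.
  + by rewrite sqrrN expr1n lexx fp ?eqxx// /d /m; lra.
  + by rewrite expr1n lexx fq ?eqxx// /d /m; lra.
Qed.

Lemma is_ovaloid_revolved p q f : p < q -> continuous f ->
  (forall t, t <= p -> f t = 0) -> (forall t, q <= t -> f t = 0) ->
  (forall t, p < t < q -> 0 < f t) ->
  (forall x y l, p <= x <= q -> p <= y <= q -> 0 <= l <= 1 ->
    l * f x + (1 - l) * f y <= f (l * x + (1 - l) * y)) ->
  (forall c, c = p \/ c = q -> forall M,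
    \forall t \near c, p <= t <= q -> M * `|t - c| <= f t) ->
  is_ovaloid (revolved p q f).
Proof.
move=> pq cf fp fq f0 conc tang; split.
- exact: closed_genus0_revolved.
- exact: convex_surface_revolved.
- exists p, q; split => //.
  + exact: revolved_zaxis.
  + by apply: revolved_tangent => //; [rewrite fp|apply: tang; left].
  + by apply: revolved_tangent => //; [rewrite fq|apply: tang; right].
Qed.

End Revolution.

(** * Profiles for positive a *)

Section PositiveProfile.
Context {R : realType}.
Implicit Types (a kap t u w : R).

(** Applied to a function and to its opposite, it extends an equality from the open interval to the
    closed one. *)
Lemma itv_oo_le_cc (l m : R) (g : R -> R) (c : R) : l < m -> continuous_at l g ->
  continuous_at m g -> (forall t, l < t < m -> g t <= c) ->
  forall t, l <= t <= m -> g t <= c.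
Proof.
move=> lm cl cm gc t /andP[lt tm].
have H u : u = l \/ u = m -> continuous_at u g -> g u <= c.
  move=> ulm cu; rewrite leNgt; apply/negP => gu.
  have /nbhs_ballP[e /= e0 eb] : \forall v \near u, c < g v.
    exact: cvgr_gt cu _ gu.
  pose d := Num.min (e / 2) ((m - l) / 2).
  have d0 : 0 < d by rewrite lt_min !divr_gt0// subr_gt0.
  have [de dm] : d <= e / 2 /\ d <= (m - l) / 2 by rewrite !ge_min !lexx orbT.
  have {}eb v : v = u + d \/ v = u - d -> c < g v.
    move=> uv; apply: eb; rewrite /ball/=; case: uv => ->.
      by rewrite opprD addrA subrr sub0r normrN gtr0_norm//; lra.
    by rewrite subKr gtr0_norm//; lra.
  case: ulm => E; subst u.
    have := gc (l + d); have := eb (l + d) (or_introl erefl).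
    rewrite ltNge => /negP h; apply: contra_not h; apply; lra.
  have := gc (m - d); have := eb (m - d) (or_intror erefl).
  by rewrite ltNge => /negP h; apply: contra_not h; apply; lra.
move: lt tm; rewrite le_eqVlt => /predU1P[<-|lt]; first by move=> _; apply: H => //; left.
rewrite le_eqVlt => /predU1P[->|tm]; first by apply: H => //; right.
by apply: gc; rewrite lt.
Qed.

(** [angle_radius] as a function of [u = sin t], that is [(e^(-kap) u)^(1/a)]. The value [0] for
    [u <= 0] makes it continuous on the line when [a > 0]. *)
Definition sin_radius a kap u : R := if 0 < u then expR ((ln u - kap) / a) else 0.

Lemma sin_radius_ge0 a kap u : 0 <= sin_radius a kap u.
Proof. by rewrite /sin_radius; case: ifP => // _; exact: expR_ge0. Qed.

Lemma sin_radius_continuous a kap : 0 < a -> continuous (sin_radius a kap).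
Proof.
move=> a0 u; have [u0|u0] := ltP 0 u.
  have h : is_derive u 1 (fun v => expR ((ln v - kap) * a^-1))
      (expR ((ln u - kap) * a^-1) *
       ((u^-1 * 1 - 0) * a^-1 + (ln u - kap) * 0)).
    exact: (is_derive_compfun (is_derive_expR _) (is_deriveMfun (is_deriveBfun
      (is_derive_compfun (is_derive1_ln u0) (is_derive_id u 1)) (is_derive_cstfun kap u))
      (is_derive_cstfun a^-1 u))).
  have hc := is_derive_continuous h.
  have E : \forall v \near u, expR ((ln v - kap) * a^-1) = sin_radius a kap v.
    by near=> v; rewrite /sin_radius ifT//; near: v; exact: lt_nbhsr.
  rewrite /continuous_at -(nbhs_singleton E); apply: cvg_trans hc.
  exact: near_eq_cvg.
rewrite /continuous_at {2}/sin_radius ltNge u0/=.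
apply/cvgrPdist_lt => e e0; near=> v.
rewrite sub0r normrN ger0_norm ?sin_radius_ge0// /sin_radius; case: ifPn => // v0.
rewrite -[ltRHS]lnK ?posrE// ltr_expR ltr_pdivrMr// ltrBlDr.
rewrite -[ltRHS]expRK ltr_ln ?posrE ?expR_gt0//.
by near: v; apply: lt_nbhsl; exact: le_lt_trans (expR_gt0 _).
Unshelve. all: by end_near. Qed.

Lemma sin_radius_sin a kap t : 0 < t < pi -> sin_radius a kap (sin t) = angle_radius a kap t.
Proof. by move=> /sin_gt0_pi st; rewrite /sin_radius st. Qed.

(** The slope [dx/dz] of the profile at angle [t] is [cot t], so every slope is attained. *)
Lemma cot_onto (M : R) : exists t : R, [/\ 0 < t < pi, cos t = M * sin t & 0 < sin t].
Proof.
have s0 : 0 < 1 + M ^+ 2 by rewrite ltr_pwDl// sqr_ge0.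
have r0 : 0 < Num.sqrt (1 + M ^+ 2) by rewrite sqrtr_gt0.
have [||t [t0 ct st]] := @sin_cos_angle R
    (M / Num.sqrt (1 + M ^+ 2)) (Num.sqrt (1 + M ^+ 2))^-1.
- rewrite exprMn exprVn sqr_sqrtr ?ltW//.
  by rewrite -[X in _ + X]mul1r -mulrDl addrC divff// gt_eqF.
- by rewrite invr_gt0.
by exists t; rewrite ct st invr_gt0.
Qed.

Variables (a kap : R) (Z : R -> R).
Hypothesis a0 : 0 < a.
Let X t := sin_radius a kap (sin t).
(** The margin around [[0, pi]], where [X] is zero, makes [Z] continuous at the two poles. *)
Hypothesis dZ : forall t, -1 < t < pi + 1 -> is_derive t 1 Z (X t / a).

Let cX : continuous X.
Proof.
move=> t; apply: (@continuous_comp _ _ _ sin (sin_radius a kap)).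
  exact: continuous_sin.
exact: sin_radius_continuous.
Qed.

Let pi0 := pi_gt0 R.

Let cZ t : 0 <= t <= pi -> {for t, continuous Z}.
Proof.
move=> /andP[t0 tpi]; apply: is_derive_continuous (dZ _); have := pi0; move=> ?.
by apply/andP; split; lra.
Qed.

Let X0 : X 0 = 0. Proof. by rewrite /X sin0 /sin_radius ltxx. Qed.
Let Xpi : X pi = 0. Proof. by rewrite /X sinpi /sin_radius ltxx. Qed.
Let X_gt0 t : 0 < t < pi -> 0 < X t.
Proof. by move=> tpi; rewrite /X sin_radius_sin// angle_radius_gt0. Qed.

Let cZ_cc u v : 0 <= u -> v <= pi -> {within `[u, v], continuous Z}.
Proof.
move=> u0 vpi; apply: continuous_in_subspaceT => t /[1!inE]/= /[1!in_itv]/= /andP[ut tv].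
by apply: cZ; rewrite (le_trans u0)// (le_trans tv).
Qed.

Let dZ_oo t : 0 < t < pi -> is_derive t 1 Z (X t / a).
Proof. by move=> /andP[? ?]; apply: dZ; apply/andP; split; have := pi0; lra. Qed.

Let Z_incr s t : 0 <= s -> s < t -> t <= pi -> Z s < Z t.
Proof.
move=> s0 st tpi; apply: (@gtr0_derive1_lt_cc _ Z 0 pi) => //.
- by move=> v; rewrite in_itv => /= /dZ_oo h; exact: (@ex_derive _ _ _ _ _ _ _ h).
- move=> v; rewrite in_itv => /= vpi; rewrite derive1E (@derive_val _ _ _ _ _ _ _ (dZ_oo vpi)).
  by rewrite divr_gt0// X_gt0.
- exact: cZ_cc.
- by rewrite in_itv/= s0 (le_trans (ltW st)).
- by rewrite in_itv/= tpi (le_trans s0)// ltW.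
Qed.

Let Z_mono s t : 0 <= s <= pi -> 0 <= t <= pi -> (Z s < Z t) = (s < t).
Proof.
move=> /andP[s0 spi] /andP[t0 tpi]; have [st|ts|->] := ltgtP s t; last exact: ltxx.
  exact: Z_incr.
by apply/negbTE; rewrite -leNgt ltW// Z_incr.
Qed.

Let Z_le s t : 0 <= s -> s <= t -> t <= pi -> Z s <= Z t.
Proof.
by move=> s0; rewrite le_eqVlt => /predU1P[->//|st] tpi; rewrite ltW// Z_incr.
Qed.

Let p := Z 0.
Let q := Z pi.

Let pq : p < q. Proof. exact: Z_incr. Qed.

Let Z_onto w : p <= w <= q -> exists2 t, 0 <= t <= pi & Z t = w.
Proof.
move=> pwq; have [|||t] := @IVT _ Z 0 pi w.
- exact: ltW.
- exact: cZ_cc.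
- by rewrite min_l ?max_r// ltW.
- by rewrite in_itv => /= tpi <-; exists t.
Qed.

Lemma positive_profile_Z_lt t : 0 < t < pi -> p < Z t < q.
Proof. by move=> /andP[t0 tpi]; rewrite !Z_incr// ltW. Qed.

Lemma positive_profile_Z_onto w : p < w < q -> exists2 t, 0 < t < pi & Z t = w.
Proof.
move=> /andP[pw wq]; have [|t /andP[t0 tpi] Zt] := @Z_onto w; first by rewrite !ltW.
exists t => //; rewrite !lt_neqAle t0 tpi !andbT.
by apply/andP; split; apply/eqP => e; move: pw wq; rewrite -Zt -?e /p /q ?e ltxx.
Qed.

(** [F] is the limiting angle, so that one statement covers both poles. *)
Lemma positive_profile_end c (F : R) : (F = 0) \/ (F = pi) -> Z F = c -> forall e, 0 < e ->
  exists2 t0, 0 < t0 < pi & forall t, 0 < t < pi ->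
    (if F == 0 then t <= t0 else t0 <= t) -> `|c - Z t| < e.
Proof.
move=> F01 ZF e e0.
have cF : {for F, continuous Z} by apply: cZ; case: F01 => ->; rewrite lexx ltW.
have /nbhs_ballP[d /= d0 db] : \forall t \near F, `|c - Z t| < e.
  by move/cvgrPdist_lt : cF => /(_ e e0); rewrite ZF.
pose m := Num.min (d / 2) (pi / 2).
have m0 : 0 < m by rewrite lt_min !divr_gt0.
have [md mpi] : m <= d / 2 /\ m <= pi / 2 by rewrite !ge_min !lexx orbT.
case: F01 => E; rewrite E ?eqxx in db *.
  exists m; first by apply/andP; split => //; have := pi0; lra.
  move=> t /andP[t0 tpi] tm; apply: db; rewrite /ball/= sub0r normrN gtr0_norm//; lra.
rewrite gt_eqF//; exists (pi - m); first by apply/andP; split; have := pi0; lra.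
move=> t /andP[t0 tpi] tm; apply: db; rewrite /ball/= gtr0_norm; lra.
Qed.

(** Coordinate of [(X t, Z t)] along [(sin t0, - cos t0)], a normal to the curve at angle [t0]. For
    [a > 0] its derivative has the sign of [sin (t0 - t)], so it is largest at [t0]. *)
Let height t0 t := X t * sin t0 - Z t * cos t0.

Let is_derive_height t0 t : 0 < t < pi ->
  is_derive t 1 (height t0) (X t * (sin (t0 - t) / (a * sin t))).
Proof.
move=> tpi; have st := sin_gt0_pi tpi.
have dX : is_derive t 1 X (X t * (cos t / (a * sin t))).
  have := is_derive_angle_radius a kap tpi; rewrite /X sin_radius_sin//.
  apply: near_eq_is_derive; near=> u; rewrite sin_radius_sin//.
  by apply/andP; split; near: u; [apply: lt_nbhsr|apply: lt_nbhsl]; case/andP: tpi.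
apply: (is_derive_eqfun (is_deriveBfun (is_deriveMfun dX (is_derive_cstfun (sin t0) t))
  (is_deriveMfun (dZ_oo tpi) (is_derive_cstfun (cos t0) t)))).
by rewrite sinB; field; rewrite !gt_eqF.
Unshelve. all: by end_near. Qed.

Let c_height t0 u v : 0 <= u -> v <= pi -> {within `[u, v], continuous (height t0)}.
Proof.
move=> u0 vpi; apply: continuous_in_subspaceT => t /[1!inE]/= /[1!in_itv]/= /andP[ut tv].
apply: cvgB; apply: cvgM; do ?exact: cvg_cst; first exact: cX.
by apply: cZ; rewrite (le_trans u0)// (le_trans tv).
Qed.

Let height_ndecr t0 s t : 0 < t0 < pi -> 0 <= s -> s <= t -> t <= t0 ->
  height t0 s <= height t0 t.
Proof.
move=> /andP[t00 t0pi] s0 st tt0.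
have sub v : v \in `]0, t0[ -> 0 < v < pi.
  by rewrite in_itv => /= /andP[-> v0]; rewrite (lt_trans v0).
apply: (@ger0_derive1_le_cc _ (height t0) 0 t0) => //.
- by move=> v /sub/(is_derive_height t0) h; exact: (@ex_derive _ _ _ _ _ _ _ h).
- move=> v vt0; have vpi := sub v vt0.
  rewrite derive1E (@derive_val _ _ _ _ _ _ _ (is_derive_height t0 vpi)).
  rewrite mulr_ge0 ?ltW ?X_gt0// divr_gt0 ?mulr_gt0 ?sin_gt0_pi//.
  by move: vt0; rewrite in_itv/= => /andP[? ?]; apply/andP; split; lra.
- by apply: c_height => //; exact: ltW.
- by rewrite in_itv/= s0 (le_trans st).
- by rewrite in_itv/= tt0 (le_trans s0).
Qed.

Let height_nincr t0 s t : 0 < t0 < pi -> t0 <= s -> s <= t -> t <= pi ->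
  height t0 t <= height t0 s.
Proof.
move=> /andP[t00 t0pi] s0 st tt0.
have sub v : v \in `]t0, pi[ -> 0 < v < pi.
  by rewrite in_itv => /= /andP[v0 ->]; rewrite (lt_trans t00).
apply: (@ler0_derive1_le_cc _ (height t0) t0 pi) => //.
- by move=> v /sub/(is_derive_height t0) h; exact: (@ex_derive _ _ _ _ _ _ _ h).
- move=> v vt0; have vpi := sub v vt0.
  rewrite derive1E (@derive_val _ _ _ _ _ _ _ (is_derive_height t0 vpi)).
  rewrite -opprB sinN mulNr mulrN oppr_le0.
  rewrite mulr_ge0 ?ltW ?X_gt0// divr_gt0 ?mulr_gt0 ?sin_gt0_pi//.
  by move: vt0; rewrite in_itv/= => /andP[? ?]; apply/andP; split; lra.
- by apply: c_height => //; exact: ltW.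
- by rewrite in_itv/= tt0 (le_trans s0).
- by rewrite in_itv/= s0 (le_trans st).
Qed.

Let Zi w := get [set t | 0 <= t <= pi /\ Z t = w].

Let ZK t : 0 <= t <= pi -> Zi (Z t) = t.
Proof.
move=> tpi; have [upi e] : [set u | 0 <= u <= pi /\ Z u = Z t] (Zi (Z t)).
  by apply: getPex; exists t.
have := Z_mono upi tpi; have := Z_mono tpi upi; rewrite e ltxx => tu ut.
by apply/eqP; rewrite eq_le !leNgt -tu -ut.
Qed.

Let clamp w := Num.max p (Num.min w q).

Let clampP w : p <= clamp w <= q.
Proof. by rewrite /clamp le_max lexx ge_max ge_min lexx orbT (ltW pq). Qed.

Let clampE w : p <= w <= q -> clamp w = w.
Proof. by move=> /andP[pw wq]; rewrite /clamp min_l// max_r. Qed.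

(* Clamping extends the profile by [0] outside of [[p, q]]. *)
Definition positive_profile w := X (Zi (clamp w)).
Local Notation f := positive_profile.

Lemma positive_profile_Z t : 0 <= t <= pi -> f (Z t) = X t.
Proof.
move=> tpi; rewrite /f clampE ?ZK//.
by move: tpi => /andP[t0 tpi]; rewrite /p /q !Z_le.
Qed.

(** The inverse [Zi] is continuous only within [[p, q]]; as [clamp] takes its values there, the
    composite is continuous on the whole line. *)
Lemma positive_profile_continuous : continuous f.
Proof.
have cZi : {within `[p, q], continuous Zi}.
  apply: segment_can_le_continuous; [exact: ltW|exact: cZ_cc|].
  by move=> t; rewrite in_itv => /= /ZK.
move=> w; apply: (@continuous_comp _ _ _ (Zi \o clamp) X); last exact: cX.
have cclamp : {for w, continuous clamp}.
  have c1 : {for w, continuous (@idfun R)} by exact: cvg_id.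
  have c2 (u : R) : {for w, continuous (fun=> u : R)} by exact: cvg_cst.
  have c3 := continuous_max (c2 p) (continuous_min c1 (c2 q)).
  exact: c3.
move/subspace_continuousP : cZi => /(_ (clamp w)).
rewrite /= in_itv/= => /(_ (clampP w)) h A /h hA.
have h2 : \forall v \near w, clamp v \in `[p, q] -> A (Zi (clamp v)).
  exact: (cclamp _ hA).
apply: filterS h2 => v /=; apply.
by rewrite in_itv/= clampP.
Qed.

Lemma positive_profile_le w : w <= p -> f w = 0.
Proof.
move=> wp; have -> : f w = f (Z 0).
  rewrite /f; congr (X (Zi _)); rewrite [RHS]clampE ?lexx ?(ltW pq)//.
  by rewrite /clamp max_l// ge_min wp.
by rewrite positive_profile_Z ?lexx ?ltW.
Qed.

Lemma positive_profile_ge w : q <= w -> f w = 0.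
Proof.
move=> qw; have -> : f w = f (Z pi).
  rewrite /f; congr (X (Zi _)); rewrite [RHS]clampE ?lexx ?(ltW pq)//.
  by rewrite /clamp min_r// max_r// ltW.
by rewrite positive_profile_Z ?lexx ?ltW.
Qed.

Lemma positive_profile_gt0 w : p < w < q -> 0 < f w.
Proof.
move=> /positive_profile_Z_onto[t tpi <-]; rewrite positive_profile_Z ?X_gt0//.
by move: tpi => /andP[/ltW -> /ltW ->].
Qed.

Let f_ge0 w : 0 <= f w. Proof. exact: sin_radius_ge0. Qed.

Lemma positive_profile_concave x y l : p <= x <= q -> p <= y <= q -> 0 <= l <= 1 ->
  l * f x + (1 - l) * f y <= f (l * x + (1 - l) * y).
Proof.
move=> /[dup] xpq /Z_onto[tx txpi ex] /[dup] ypq /Z_onto[ty typi ey] /andP[l0 l1].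
set w := l * x + _.
move: xpq ypq => /andP[px xq] /andP[py yq].
have pw : p <= w by rewrite /w; nra.
have wq : w <= q by rewrite /w; nra.
(* At a pole the tangent is vertical and gives no support inequality. If the combination [w] is an
   end of [[p, q]], each of [x] and [y] equals that end or has weight zero, and the left side
   vanishes. *)
have extreme c : f c = 0 -> l * (x - c) = 0 -> (1 - l) * (y - c) = 0 ->
    l * f x + (1 - l) * f y = 0.
  move=> fc /eqP + /eqP; rewrite !mulf_eq0 !subr_eq0.
  by move=> /orP[]/eqP-> /orP[]/eqP e; rewrite ?e ?fc; lra.
move: pw; rewrite le_eqVlt => /predU1P[pw|pw].
  by rewrite (@extreme p) ?f_ge0// ?positive_profile_le//; move: pw; rewrite /w; nra.
move: wq; rewrite le_eqVlt => /predU1P[wq|wq].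
  by rewrite (@extreme q) ?f_ge0// ?positive_profile_ge//; move: wq; rewrite /w; nra.
have [|t0 t0pi e0] := @positive_profile_Z_onto w; first by rewrite pw.
have supp t : 0 <= t <= pi -> height t0 t <= height t0 t0.
  move=> /andP[t_ge0 tpi]; have [tt0|/ltW tt0] := leP t t0.
    exact: height_ndecr.
  exact: height_nincr.
have st0 := sin_gt0_pi t0pi.
(* In the weighted sum of the two support inequalities the [cos t0] terms cancel, since [w] is the
   barycentre; what remains is the claim multiplied by [sin t0 > 0]. *)
have := supp _ txpi; have := supp _ typi.
rewrite -{1}e0 /height -!positive_profile_Z//; last by move: t0pi => /andP[/ltW -> /ltW ->].
rewrite ex ey e0 /w => hy hx.
rewrite -(ler_pM2r st0).
have l1' : 0 <= 1 - l by lra.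
have := ler_wpM2l l0 hx; have := ler_wpM2l l1' hy.
by rewrite -/w; set W := f w; rewrite /w; lra.
Qed.

(** Take [t0] with [cot t0 = M]. Comparing [height t0] at the pole and at a nearby point bounds [f]
    below by the line of slope [M] through the pole; at [q] the slope is [- M]. *)
Lemma positive_profile_tangent c : c = p \/ c = q -> forall M,
  \forall w \near c, p <= w <= q -> M * `|w - c| <= f w.
Proof.
case=> -> M.
  have [t0 [t0pi ct st]] := cot_onto M.
  have pZ : p < Z t0 by have /andP[] := positive_profile_Z_lt t0pi.
  near=> w; move=> /[dup] /andP[pw _] /Z_onto[t tpi e].
  have wZ : w < Z t0 by near: w; exact: lt_nbhsl.
  have t0pi' : 0 <= t0 <= pi by move: t0pi => /andP[/ltW -> /ltW ->].
  have tt0 : t < t0 by rewrite -Z_mono// e.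
  have [t_ge0 _] := andP tpi.
  have := height_ndecr t0pi (lexx 0) t_ge0 (ltW tt0).
  rewrite /height X0 -(positive_profile_Z tpi) e ct -/p => h.
  by rewrite ger0_norm ?subr_ge0// -(ler_pM2r st); lra.
have [t0 [t0pi ct st]] := cot_onto (- M).
have pZ : Z t0 < q by have /andP[] := positive_profile_Z_lt t0pi.
near=> w; move=> /[dup] /andP[_ wq] /Z_onto[t tpi e].
have wZ : Z t0 < w by near: w; exact: lt_nbhsr.
have t0pi' : 0 <= t0 <= pi by move: t0pi => /andP[/ltW -> /ltW ->].
have tt0 : t0 < t by rewrite -Z_mono// e.
have [_ t_le] := andP tpi.
have := height_nincr t0pi (ltW tt0) t_le (lexx pi).
rewrite /height Xpi -(positive_profile_Z tpi) e ct -/q => h.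
by rewrite distrC ger0_norm ?subr_ge0// -(ler_pM2r st); lra.
Unshelve. all: by end_near. Qed.

(* For [a = 1] the radius is [r sin t], so [Z = c - r cos t]. *)
Lemma positive_profile_circle : a = 1 -> exists c r : R, [/\ 0 < r, p = c - r, q = c + r &
  forall w, p <= w <= q -> f w ^+ 2 = r ^+ 2 - (w - c) ^+ 2].
Proof.
move=> a1; pose r := expR (- kap).
have Xr t : 0 <= t <= pi -> X t = r * sin t.
  move=> /andP[]; rewrite le_eqVlt => /predU1P[<-|t0]; first by rewrite X0 sin0 mulr0.
  rewrite le_eqVlt => /predU1P[->|tpi]; first by rewrite Xpi sinpi mulr0.
  have st : 0 < sin t by rewrite sin_gt0_pi// t0.
  by rewrite /X /sin_radius st a1 divr1 addrC expRD lnK// posrE.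
have pi2 : 0 < (pi / 2 : R) < pi by have := pi0 => ?; apply/andP; split; lra.
pose g t := Z t + r * cos t.
have cg t : 0 <= t <= pi -> {for t, continuous g}.
  by move=> tpi; apply: cvgD; [exact: cZ|apply: cvgM; [exact: cvg_cst|exact: continuous_cos]].
have dg t : 0 < t < pi -> is_derive t 1 g 0.
  move=> tpi; apply: (is_derive_eqfun (is_deriveDfun (dZ_oo tpi)
    (is_deriveZfun r (is_derive_cos t)))).
  by rewrite Xr ?a1 ?divr1; [ring|move: tpi => /andP[/ltW -> /ltW ->]].
pose c := g (pi / 2).
have gc t : 0 < t < pi -> g t = c.
  by by move=> tpi; exact: (derive0_cst (I := [set t | 0 < t < pi]) (@is_interval_0pi R)).
have {}gc t : 0 <= t <= pi -> g t = c.
  move=> tpi; apply/eqP; rewrite eq_le; apply/andP; split.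
    by apply: (@itv_oo_le_cc 0 pi g c pi0 _ _ _ t tpi); [apply: cg|apply: cg|move=> u /gc ->];
      rewrite ?lexx ?ltW.
  rewrite -lerN2; apply: (@itv_oo_le_cc 0 pi (fun t => - g t) (- c) pi0 _ _ _ t tpi);
    [apply: cvgN; apply: cg|apply: cvgN; apply: cg|move=> u /gc ->]; rewrite ?lexx ?ltW//.
have Zc t : 0 <= t <= pi -> Z t = c - r * cos t by move=> /gc <-; rewrite /g addrK.
exists c, r; split; first exact: expR_gt0.
- by rewrite /p Zc ?lexx ?ltW// cos0 mulr1.
- by rewrite /q Zc ?lexx ?ltW// cospi mulrN1 opprK.
- move=> w /Z_onto[t tpi <-]; rewrite positive_profile_Z// Xr// Zc//.
  by rewrite exprMn sin2cos2; ring.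
Qed.

End PositiveProfile.

(** * Profiles for negative a *)

Section NegativeProfile.
Context {R : realType}.
Variables (a kap : R) (Z : R -> R).
Hypothesis a0 : a < 0.
Local Notation X := (angle_radius a kap).
Hypothesis dZ : forall t, 0 < t < pi -> is_derive t 1 Z (X t / a).

Let pi0 := pi_gt0 R.
Let an0 : a != 0. Proof. by rewrite lt_eqF. Qed.

Let reflect_0pi (t : R) : (0 < pi - t < pi) = (0 < t < pi).
Proof. by rewrite subr_gt0 gtrBl andbC. Qed.

Let Z_decr s t : 0 < s < pi -> 0 < t < pi -> s < t -> Z t < Z s.
Proof.
move=> spi tpi st; rewrite -ltrN2.
apply: (derive_gt0_incr (I := [set t | 0 < t < pi]) (f := fun t => - Z t)
  (df := fun t => -1 * (X t / a)) (@is_interval_0pi R)) => // u upi.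
  by have := is_deriveZfun (-1) (dZ upi); under eq_fun do rewrite mulN1r.
by rewrite mulN1r oppr_gt0 pmulr_rlt0 ?invr_lt0// angle_radius_gt0.
Qed.

Let Z_mono s t : 0 < s < pi -> 0 < t < pi -> (Z t < Z s) = (s < t).
Proof.
move=> spi tpi; have [st|ts|->] := ltgtP s t; last exact: ltxx.
  exact: Z_decr.
by apply/negbTE; rewrite -leNgt ltW// Z_decr.
Qed.

Let cZ t : 0 < t < pi -> {for t, continuous Z}.
Proof. by move=> /dZ/is_derive_continuous. Qed.

Definition negative_domain := [set Z t | t in [set t | 0 < t < pi]].
Local Notation J := negative_domain.

Lemma negative_domain_interval : is_interval J.
Proof.
move=> _ _ [s spi <-] [t tpi <-] w /(preimage_between (@is_interval_0pi R) cZ spi tpi).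
by move=> [u upi <-]; exists u.
Qed.

Lemma negative_domain_open : open J.
Proof.
have -> : J = [set s | exists2 t, [set t | 0 < t < pi] t & - Z t = -1 * s + 0].
  apply/seteqP; split => [_ [t tpi <-]|s [t tpi e]].
    by exists t => //; rewrite mulN1r addr0.
  by exists t => //; apply: oppr_inj; rewrite e mulN1r addr0.
apply: open_affine_preimage_incr_image.
- exact: is_interval_0pi.
- exact: open_0pi.
- by move=> t tpi; apply: continuousN; exact: cZ.
- by move=> s t spi tpi st; rewrite ltrN2 Z_decr.
Qed.

Lemma negative_domain_nonempty : J !=set0.
Proof.
exists (Z (pi / 2)), (pi / 2) => //=.
by apply/andP; split; have := pi0; lra.
Qed.

Let Zi w := get [set t | 0 < t < pi /\ Z t = w].

Let ZK t : 0 < t < pi -> Zi (Z t) = t.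
Proof.
move=> tpi; have [upi e] : [set u | 0 < u < pi /\ Z u = Z t] (Zi (Z t)).
  by apply: getPex; exists t.
have := Z_mono upi tpi; have := Z_mono tpi upi; rewrite e ltxx => tu ut.
by apply/eqP; rewrite eq_le !leNgt -tu -ut.
Qed.

Definition negative_profile w := X (Zi w).
Local Notation f := negative_profile.

Lemma negative_profile_Z t : 0 < t < pi -> f (Z t) = X t.
Proof. by move=> tpi; rewrite /f ZK. Qed.

Let height t0 t := X t * sin t0 - Z t * cos t0.

Let is_derive_height t0 t : 0 < t < pi ->
  is_derive t 1 (height t0) (X t / (- a * sin t) * sin (t - t0)).
Proof.
move=> tpi; have st := sin_gt0_pi tpi.
apply: (is_derive_eqfun (is_deriveBfun
  (is_deriveMfun (is_derive_angle_radius a kap tpi) (is_derive_cstfun (sin t0) t))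
  (is_deriveMfun (dZ tpi) (is_derive_cstfun (cos t0) t)))).
by rewrite sinB; field; rewrite ?oppr_eq0 an0 gt_eqF.
Qed.

Let height_coef_ge0 t : 0 < t < pi -> 0 <= X t / (- a * sin t).
Proof.
move=> tpi; rewrite divr_ge0 ?ltW ?angle_radius_gt0//.
by rewrite mulr_gt0 ?oppr_gt0// sin_gt0_pi.
Qed.

(** For [a < 0] the derivative of the height has the sign of [sin (t - t0)]: the curve lies on the
    opposite side of its tangents from the case [a > 0]. *)
Let height_min t0 t : 0 < t0 < pi -> 0 < t < pi -> height t0 t0 <= height t0 t.
Proof.
move=> t0pi tpi; have [t00 t0lt] := andP t0pi; have [tgt tlt] := andP tpi.
have [le|/ltW le] := leP t0 t.
  have itv : is_interval [set u : R | t0 <= u < pi].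
    by move=> u v /= /andP[u0 _] /andP[_ vpi] w /andP[uw wv];
      rewrite (le_trans u0 uw) (le_lt_trans wv vpi).
  have sub u : t0 <= u < pi -> 0 < u < pi.
    by move=> /andP[t0u ->]; rewrite (lt_le_trans t00).
  apply: (derive_ge0_ndecr itv (fun u uI => is_derive_height t0 (sub u uI))) => //=;
    rewrite ?lexx ?le// => u uI.
  rewrite mulr_ge0 ?height_coef_ge0 ?sub// sin_ge0_pi//.
  by move: uI => /andP[? ?]; apply/andP; split; lra.
have itv : is_interval [set u : R | 0 < u <= t0].
  by move=> u v /= /andP[u0 _] /andP[_ vpi] w /andP[uw wv];
    rewrite (lt_le_trans u0 uw) (le_trans wv vpi).
have sub u : 0 < u <= t0 -> 0 < u < pi.
  by move=> /andP[-> ut0]; rewrite (le_lt_trans ut0).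
rewrite -lerN2 -mulN1r -[leRHS]mulN1r.
apply: (derive_ge0_ndecr itv
  (fun u uI => is_deriveZfun (-1) (is_derive_height t0 (sub u uI)))) => //=;
  rewrite ?lexx ?le ?tgt ?t00// => u uI.
rewrite mulN1r -mulrN -sinN opprB mulr_ge0 ?height_coef_ge0 ?sub// sin_ge0_pi//.
by move: uI => /andP[? ?]; apply/andP; split; lra.
Qed.

Lemma negative_profile_convex x y l : J x -> J y -> 0 <= l <= 1 ->
  f (l * x + (1 - l) * y) <= l * f x + (1 - l) * f y.
Proof.
move=> Jx Jy /andP[l0 l1]; set w := l * x + _.
have [t0 t0pi e0] : J w.
  have [xy|/ltW yx] := leP x y.
    by apply: (negative_domain_interval Jx Jy); rewrite /w; apply/andP; split; nra.
  by apply: (negative_domain_interval Jy Jx); rewrite /w; apply/andP; split; nra.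
move: Jx Jy => [tx txpi ex] [ty typi ey].
have st0 := sin_gt0_pi t0pi.
have := height_min t0pi txpi; have := height_min t0pi typi.
rewrite /height -!negative_profile_Z// ex ey e0 => hy hx.
rewrite -(ler_pM2r st0).
have l1' : 0 <= 1 - l by lra.
have := ler_wpM2l l0 hx; have := ler_wpM2l l1' hy.
by set W := f w; rewrite /w; lra.
Qed.

(** The radius is invariant under [t -> pi - t], so the profile is symmetric about the height
    [Z (pi / 2)] and estimates near angle [0] suffice. *)
Let Z_sym t : 0 < t < pi -> Z (pi - t) = 2 * Z (pi / 2) - Z t.
Proof.
have pi2 : 0 < (pi / 2 : R) < pi by have := pi0 => ?; apply/andP; split; lra.
move=> tpi; suff : Z (pi - t) + Z t = Z (pi - pi / 2) + Z (pi / 2).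
  have -> : pi - pi / 2 = pi / 2 :> R by field.
  lra.
apply: (derive0_cst (I := [set t | 0 < t < pi]) (f := fun t => Z (pi - t) + Z t)
  (@is_interval_0pi R)) => // u upi.
have dr : is_derive u 1 (fun u : R => pi - u) (0 - 1).
  exact: (is_deriveBfun (is_derive_cstfun pi u) (is_derive_id u 1)).
have dZr : is_derive (pi - u) 1 Z (X (pi - u) / a) by apply: dZ; rewrite reflect_0pi.
apply: (is_derive_eqfun (is_deriveDfun (is_derive_compfun (g := fun u => pi - u) dZr dr)
  (dZ upi))).
have -> : X (pi - u) = X u.
  by rewrite /angle_radius sinB sinpi cospi mul0r sub0r mulN1r opprK.
by ring.
Qed.

Lemma sin_small (d : R) : 0 < d -> exists2 t0 : R, 0 < t0 < pi / 2 &
  forall t, 0 < t < pi -> t <= t0 \/ pi - t0 <= t -> sin t < d.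
Proof.
move=> d0.
have /nbhs_ballP[e /= e0 eb] : \forall t \near (0 : R), sin t < d.
  by have := @continuous_sin R 0; rewrite /continuous_at sin0 => c; exact: cvgr_lt c _ d0.
pose t0 := Num.min (e / 2) (pi / 4).
have t00 : 0 < t0 by rewrite lt_min !divr_gt0.
have [te tpi4] : t0 <= e / 2 /\ t0 <= pi / 4 by rewrite !ge_min !lexx orbT.
exists t0; first by apply/andP; split => //; have := pi0 => ?; lra.
move=> t /andP[tgt tlt] [tt0|tt0].
  by apply: eb; rewrite /ball/= sub0r normrN gtr0_norm//; lra.
have -> : sin t = sin (pi - t) by rewrite sinB sinpi cospi mul0r sub0r mulN1r opprK.
by apply: eb; rewrite /ball/= sub0r normrN gtr0_norm; lra.
Qed.

Lemma negative_profile_ends (M : R) : exists2 t0 : R, 0 < t0 < pi / 2 &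
  forall t, 0 < t < pi -> t <= t0 \/ pi - t0 <= t -> M < X t.
Proof.
(* [N] replaces [M] by a positive bound so that [ln N] is meaningful; as [a < 0], [N < X t] amounts
   to [sin t < e^(kap + a ln N)]. *)
pose N := Num.max M 1; have N0 : 0 < N by rewrite lt_max ltr01 orbT.
have [t0 t0pi small] := sin_small (expR_gt0 (kap + a * ln N)).
exists t0 => // t tpi tt0; apply: (@le_lt_trans _ _ N); first by rewrite le_max lexx.
have st := sin_gt0_pi tpi.
rewrite -[ltLHS]lnK ?posrE// ltr_expR ltr_ndivlMr// ltrBlDr addrC mulrC.
by rewrite -[ltRHS]expRK ltr_ln ?posrE ?expR_gt0//; exact: small.
Qed.

(** The sign of [1 + 1/a] separates the two regimes: with [C = e^(-kap/a)], [X sin] is at least [C]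
    when [-1 <= a < 0] and at most [C] when [a < -1]. *)
Let X_sin t : 0 < t < pi -> X t * sin t = expR ((1 + a^-1) * ln (sin t) - kap / a).
Proof.
move=> tpi; transitivity (X t * expR (ln (sin t))).
  by rewrite lnK ?posrE ?sin_gt0_pi.
by rewrite -expRD; congr expR; field.
Qed.

Let ln_sin_le0 (t : R) : ln (sin t) <= 0. Proof. by rewrite ln_le0// sin_le1. Qed.

Lemma negative_domain_setT : -1 <= a -> J = setT.
Proof.
move=> a1; pose C := expR (- (kap / a)).
have C0 : 0 < C := expR_gt0 _.
have XC t : 0 < t < pi -> C <= X t * sin t.
  move=> tpi; rewrite X_sin// ler_expR lerDr mulr_le0//.
  rewrite -(ler_nM2l a0) mulr0 mulrDr mulr1 divff//; lra.
(* From [X >= C / sin >= C cos / sin], [- Z] grows at least as fast as [- (C / a) ln sin]. Comparing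
   with this elementary primitive forces [Z] to [+oo] as the angle tends to [0]. *)
pose U t := - Z t + C / a * ln (sin t).
have dU t : 0 < t < pi -> is_derive t 1 U ((- a)^-1 * (X t - C * (cos t / sin t))).
  move=> tpi; have st := sin_gt0_pi tpi.
  have := is_deriveDfun (is_deriveZfun (-1) (dZ tpi))
    (is_deriveZfun (C / a) (is_derive_compfun (is_derive1_ln st) (is_derive_sin t))).
  under eq_fun do rewrite mulN1r.
  by move=> h; apply: (is_derive_eqfun h); field; rewrite ?oppr_eq0 an0 gt_eqF.
have Uincr : forall s t, 0 < s < pi -> 0 < t < pi -> s <= t -> U s <= U t.
  apply: (derive_ge0_ndecr (@is_interval_0pi R) dU) => t tpi.
  have st := sin_gt0_pi tpi.
  rewrite mulr_ge0 ?invr_ge0 ?oppr_ge0 ?(ltW a0)// subr_ge0 mulrA ler_pdivrMr//.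
  by apply: le_trans (XC t tpi); rewrite ger_pMr// cos_le1.
have pi2 : 0 < (pi / 2 : R) < pi by have := pi0 => ?; apply/andP; split; lra.
have up (M : R) : exists2 t, 0 < t < pi & M < Z t.
  pose L := (M + U (pi / 2)) / (C / a).
  have [t0 /andP[t00 t0pi] small] := sin_small (expR_gt0 L).
  have tpi : 0 < t0 < pi by rewrite t00/=; have := pi0; lra.
  exists t0 => //; have := Uincr _ _ tpi pi2 (ltW t0pi).
  have : ln (sin t0) < L.
    rewrite -[ltRHS]expRK ltr_ln ?posrE ?expR_gt0 ?sin_gt0_pi//.
    by apply: small => //; left.
  have Ca : C / a < 0 by rewrite pmulr_rlt0// invr_lt0.
  rewrite /L ltr_ndivlMr// => h1; rewrite {1}/U => h2; lra.
apply/seteqP; split => // w _.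
(* Unboundedness above also gives it below, by reflection. *)
have [t tpi wt] := up w; have [s spi ws] := up (2 * Z (pi / 2) - w).
apply: (negative_domain_interval (x := Z (pi - s)) (y := Z t)).
- by exists (pi - s) => //=; rewrite reflect_0pi.
- by exists t.
- by rewrite Z_sym//; apply/andP; split; lra.
Qed.

Let Z_bounded : a < -1 -> exists B, forall t, 0 < t < pi -> Z t <= B.
Proof.
move=> a1; pose C := expR (- (kap / a)); pose b := 1 + a^-1.
have b0 : 0 < b.
  by rewrite /b -(ltr_nM2l a0) mulr0 mulrDr mulr1 divff//; lra.
have XC t : 0 < t < pi -> X t * sin t <= C.
  by move=> tpi; rewrite X_sin// ler_expR gerDr mulr_ge0_le0// ltW.
(* [X sin] has derivative [b X cos], so [Q' = (X cos + C - X) / (- a)]. This is nonnegative up to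
   [pi / 2], because there [1 <= cos + sin] and [X sin <= C]. The terms added to [Z] are
   nonnegative, hence [Z <= Q <= Q (pi / 2)]. *)
pose Q t := Z t + (- a)^-1 * (b^-1 * (X t * sin t) + C * t).
have dQ t : 0 < t < pi -> is_derive t 1 Q ((- a)^-1 * (X t * cos t + C - X t)).
  move=> tpi; have st := sin_gt0_pi tpi.
  apply: (is_derive_eqfun (is_deriveDfun (dZ tpi) (is_deriveZfun _ (is_deriveDfun
    (is_deriveZfun b^-1 (is_deriveMfun (is_derive_angle_radius a kap tpi) (is_derive_sin t)))
    (is_deriveZfun C (is_derive_id t 1)))))).
  have -> : X t * (cos t / (a * sin t)) * sin t + X t * cos t = b * (X t * cos t).
    by rewrite /b; field; rewrite an0 gt_eqF.
  by rewrite mulrA mulVf ?gt_eqF//; field; rewrite ?oppr_eq0 ?an0.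
have pi2 : 0 < (pi / 2 : R) < pi by have := pi0 => ?; apply/andP; split; lra.
have Qincr t : 0 < t -> t <= pi / 2 -> Q t <= Q (pi / 2).
  have itv : is_interval [set u : R | 0 < u <= pi / 2].
    by move=> u v /= /andP[u0 _] /andP[_ vpi] w /andP[uw wv];
      rewrite (lt_le_trans u0 uw) (le_trans wv vpi).
  have sub (u : R) : 0 < u <= pi / 2 -> 0 < u < pi.
    by move=> /andP[u0 u2]; rewrite u0/=; have := pi0 => ?; lra.
  have Qge0 (u : R) : 0 < u <= pi / 2 -> 0 <= (- a)^-1 * (X u * cos u + C - X u).
    move=> uI; have upi := sub u uI.
    rewrite mulr_ge0 ?invr_ge0 ?oppr_ge0 ?(ltW a0)//.
    have cs : 1 <= cos u + sin u.
      have c0 : 0 <= cos u.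
        by rewrite cos_ge0_pihalf//; move: uI => /andP[? ?]; apply/andP; split; lra.
      by have s0 := sin_gt0_pi upi; have := cos2Dsin2 u; nra.
    by have := XC u upi; have := ler_wpM2l (ltW (angle_radius_gt0 a kap u)) cs; lra.
  move=> t0 t2; apply: (derive_ge0_ndecr itv (fun u uI => dQ u (sub u uI)) Qge0) => //=.
    by rewrite t0.
  by rewrite lexx andbT; case/andP: pi2.
exists (Q (pi / 2)) => t tpi; have [t0 tlt] := andP tpi.
have ZQ u : 0 < u < pi -> Z u <= Q u.
  move=> upi; rewrite lerDl mulr_ge0 ?invr_ge0 ?oppr_ge0 ?(ltW a0)//.
  rewrite addr_ge0 ?mulr_ge0 ?invr_ge0 ?(ltW b0) ?expR_ge0 ?(ltW (angle_radius_gt0 _ _ _))//.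
    by rewrite ltW// sin_gt0_pi.
  by case/andP: upi => /ltW.
have [t2|t2] := leP t (pi / 2); first exact: le_trans (ZQ _ tpi) (Qincr _ t0 t2).
by apply: le_trans (ZQ _ pi2); rewrite ltW// Z_decr.
Qed.

Lemma negative_domain_ends : a < -1 -> exists p q : R, [/\ p < q,
  forall t, 0 < t < pi -> p <= Z t <= q &
  forall e, 0 < e -> exists2 t0, 0 < t0 < pi & forall t, 0 < t < pi ->
    (t <= t0 -> `|q - Z t| < e) /\ (pi - t0 <= t -> `|p - Z t| < e)].
Proof.
move=> a1; have [B ZB] := Z_bounded a1.
have pi2 : 0 < (pi / 2 : R) < pi by have := pi0 => ?; apply/andP; split; lra.
have supJ : has_sup J.
  split; first exact: negative_domain_nonempty.
  by exists B => _ [t tpi <-]; exact: ZB.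
(* [Z] is decreasing, so its supremum is the limit at angle [0]; the limit at [pi] is the reflected
   value. *)
pose q := sup J; pose p := 2 * Z (pi / 2) - q.
have Zq t : 0 < t < pi -> Z t <= q.
  by move=> tpi; apply: ub_le_sup => //; [exact: supJ.2|exists t].
have Zp t : 0 < t < pi -> p <= Z t.
  by move=> tpi; have := @Zq (pi - t); rewrite reflect_0pi => /(_ tpi); rewrite Z_sym// /p; lra.
have qZ : Z (pi / 2) < q.
  have pi4 : 0 < (pi / 4 : R) < pi by have := pi0 => ?; apply/andP; split; lra.
  by apply: lt_le_trans (Zq _ pi4); apply: Z_decr => //; have := pi0; lra.
exists p, q; split; first by rewrite /p; lra.
  by move=> t tpi; rewrite Zp ?Zq.
move=> e e0; have [_ [t0 t0pi <-] qe] := sup_adherent e0 supJ.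
have near0 t : 0 < t < pi -> t <= t0 -> `|q - Z t| < e.
  move=> tpi tt0; rewrite ger0_norm ?subr_ge0 ?Zq//.
  have : Z t0 <= Z t by rewrite leNgt Z_mono// -leNgt.
  by move: qe; rewrite -/q; lra.
exists t0 => // t tpi; split; first exact: near0.
move=> tt0; have := near0 (pi - t); rewrite reflect_0pi => /(_ tpi).
rewrite Z_sym// => h; rewrite /p -normrN opprB.
by rewrite (_ : _ - _ = q - (2 * Z (pi / 2) - Z t)); [apply: h; lra|ring].
Qed.

End NegativeProfile.

(** * Ends of the curve and the plane case *)

Section Ends.
Context {R : realType}.
Implicit Types (I J : set R) (x z th T f : R -> R).

Lemma lower_end_proper I : I !=set0 -> ProperFilter (lower_end I).
Proof.
move=> I0; apply: filter_from_proper; last by move=> s Is; exists s.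
apply: filter_from_filter => // s t Is It; exists (Num.min s t).
  by case: (leP s t).
by move=> u [Iu]; rewrite le_min => /andP[us ut].
Qed.

Lemma upper_end_proper I : I !=set0 -> ProperFilter (upper_end I).
Proof.
move=> I0; apply: filter_from_proper; last by move=> s Is; exists s.
apply: filter_from_filter => // s t Is It; exists (Num.max s t).
  by case: (leP s t).
by move=> u [Iu]; rewrite ge_max => /andP[us ut].
Qed.

(** Hides the orientation: [F0] is the end of [I] where the angle tends to [0], and [F1] the one
    where it tends to [pi]. *)
Lemma angle_ends I T : I !=set0 -> (forall t, 0 < t < pi -> exists2 s, I s & T s = t) ->
  (forall s u, I s -> I u -> s < u -> T s < T u) \/
  (forall s u, I s -> I u -> s < u -> T u < T s) ->
  exists F0 F1 : set_system R, [/\ ProperFilter F0, ProperFilter F1,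
    F0 = lower_end I /\ F1 = upper_end I \/ F0 = upper_end I /\ F1 = lower_end I &
    forall t, 0 < t < pi -> F0 [set s | I s /\ T s <= t] /\ F1 [set s | I s /\ t <= T s]].
Proof.
move=> I0 onto mono; have [lp up] := (lower_end_proper I0, upper_end_proper I0).
case: mono => mono.
  have {}mono s u : I s -> I u -> s <= u -> T s <= T u.
    by move=> Is Iu; rewrite le_eqVlt => /predU1P[->//|su]; rewrite ltW// mono.
  exists (lower_end I), (upper_end I); split => // [|t tpi]; first by left.
  by have [s Is <-] := onto t tpi; split; exists s => //= u [Iu us]; split=> //; exact: mono.
have {}mono s u : I s -> I u -> s <= u -> T u <= T s.
  by move=> Is Iu; rewrite le_eqVlt => /predU1P[->//|su]; rewrite ltW// mono.
exists (upper_end I), (lower_end I); split => // [|t tpi]; first by right.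
by have [s Is <-] := onto t tpi; split; exists s => //= u [Iu us]; split=> //; exact: mono.
Qed.

Lemma generating_curveE I x z (F0 F1 : set_system R) :
  F0 = lower_end I /\ F1 = upper_end I \/ F0 = upper_end I /\ F1 = lower_end I ->
  generating_curve I x z = [set (x s, z s) | s in I] `|`
    [set Q | Q.1 = 0 /\ ((x s, z s) @[s --> F0] --> Q \/ (x s, z s) @[s --> F1] --> Q)].
Proof.
case=> -[-> ->] //; rewrite /generating_curve; congr (_ `|` _).
by apply/seteqP; split => Q /= [? [?|?]]; split => //; by [right|left].
Qed.

Lemma convex_functionI J f : (forall x y l : R, J x -> J y -> 0 <= l <= 1 ->
    f (l * x + (1 - l) * y) <= l * f x + (1 - l) * f y) ->
  convex_function (J : set R) f.
Proof.
move=> H l x y /set_mem Jx /set_mem Jy; apply: (H x y l%:num Jx Jy).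
by rewrite ge0 le1.
Qed.

Lemma bounded_setI (p q : R) J : (forall t, J t -> p <= t <= q) -> bounded_set J.
Proof.
move=> Jpq; exists (Num.max `|p| `|q|); split; first exact: num_real.
move=> M; rewrite gt_max => /andP[pM qM] t /Jpq /andP[pt tq] /=.
rewrite ler_norml; apply/andP; split.
  by have := ler_norm (- p); rewrite normrN => h; lra.
by have := ler_norm q => h; lra.
Qed.

Lemma cvg_pair_fst (F : set_system R) {FF : Filter F} x z (Q : R * R) :
  (x s, z s) @[s --> F] --> Q -> x s @[s --> F] --> Q.1.
Proof.
move=> h; have c : {for Q, continuous fst} by exact: cvg_fst.
exact: (@cvg_comp _ _ _ _ fst _ _ _ h c). Qed.

Lemma cvg_pair_snd (F : set_system R) {FF : Filter F} x z (Q : R * R) :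
  (x s, z s) @[s --> F] --> Q -> z s @[s --> F] --> Q.2.
Proof.
move=> h; have c : {for Q, continuous snd} by exact: cvg_snd.
exact: (@cvg_comp _ _ _ _ snd _ _ _ h c). Qed.

End Ends.

(** * Curves orthogonal to the axis *)

Section PlaneCase.
Context {R : realType}.
Implicit Types (I J : set R) (x z th : R -> R).

Lemma plane_of_half_line (c : R) :
  is_plane (surface_of_revolution [set Q : R * R | 0 <= Q.1 /\ Q.2 = c]).
Proof.
exists ((0, 0), 1), c.
  by apply/eqP => /(congr1 snd)/eqP; rewrite /= oner_eq0.
apply/seteqP; split => -[[X Y] Z]; rewrite /dot3/= !mul0r !add0r mul1r.
  by move=> [[u v] /= [_ ->] [phi [_ _ ->]]].
move=> ->; have XY : 0 <= X ^+ 2 + Y ^+ 2 by rewrite addr_ge0 ?sqr_ge0.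
have [r r0 e] : exists2 r, 0 <= r & X ^+ 2 + Y ^+ 2 = r ^+ 2.
  by exists (Num.sqrt (X ^+ 2 + Y ^+ 2)); rewrite ?sqrtr_ge0 ?sqr_sqrtr.
have [phi [-> ->]] := polar_coordinates r0 e.
by exists (r, c) => //; exists phi.
Qed.

Lemma horizontal_curve a I x z th s0 : maximal_linear_weingarten a I x z th ->
  I s0 -> sin (th s0) = 0 ->
  is_plane (surface_of_revolution (generating_curve I x z)).
Proof.
move=> [lw mx] I0 sin0; have [[_ _ itvI _] _] := lw.
have sinI s : I s -> sin (th s) = 0.
  move=> Is; have := first_integral lw Is I0; rewrite sin0 mul0r => /eqP.
  by rewrite mulf_eq0 expR_eq0 orbF => /eqP.
have thI s : I s -> th s = th s0.
  move=> Is; apply: (derive0_cst itvI) => // u Iu.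
  have [_ _ _ dth] := linear_weingartenP lw Iu.
  by apply: (is_derive_eqfun dth); rewrite sinI// mul0r mulr0.
have zI s : I s -> z s = z s0.
  move=> Is; apply: (derive0_cst itvI) => // u Iu.
  have [_ _ dz _] := linear_weingartenP lw Iu.
  by apply: (is_derive_eqfun dz); rewrite sinI.
pose eps := cos (th s0).
have eps2 : eps * eps = 1 by have := cos2Dsin2 (th s0); rewrite sin0 expr0n addr0 expr2.
pose x1 s := eps * s + (x s0 - eps * s0).
have dx1 (s : R) : is_derive s 1 x1 eps.
  apply: (is_derive_eqfun (is_deriveDfun (is_deriveZfun eps (is_derive_id s 1))
    (is_derive_cstfun _ s))).
  by rewrite mulr1 addr0.
have xI s : I s -> x s = x1 s.
  move=> Is; suff : x s - x1 s = x s0 - x1 s0 by rewrite /x1; lra.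
  apply: (derive0_cst (f := fun s => x s - x1 s) itvI) => // u Iu.
  have [_ dx _ _] := linear_weingartenP lw Iu.
  by apply: (is_derive_eqfun (is_deriveBfun dx (dx1 u))); rewrite thI// subrr.
(* The whole parameter half-line on which the affine radius is positive. Maximality identifies it
   with [I], so the curve reaches the axis and is unbounded. *)
pose J := [set s | 0 < x1 s].
have x0 s : I s -> 0 < x s by move=> Is; have [] := linear_weingartenP lw Is.
have IJ : I `<=` J by move=> s Is; rewrite /J/= -xI// x0.
have lwJ : linear_weingarten a J x1 (fun=> z s0) (fun=> th s0).
  split; last first.
    by move=> s _; rewrite /kappa1 /kappa2 sin0 mul0r mulr0 derive1_cst.
  split; first by exists s0; exact: IJ.
  - apply: (@open_comp _ _ x1 [set u | 0 < u]); last exact: open_gt.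
    by move=> s _; exact: is_derive_continuous (dx1 s).
  - move=> s t; rewrite /J/= /x1 => xs xt u /andP[su ut].
    by have [e0|/ltW e0] := leP 0 eps; nra.
  - move=> s Js; split => //; first by rewrite sin0; exact: is_derive_cstfun.
have JI : J `<=` I.
  by apply: mx lwJ IJ _ => s Is; rewrite xI// zI// thI.
have onto u : 0 < u -> exists2 s, I s & x s = u.
  move=> u0; have e : x1 (s0 + eps * (u - x s0)) = u.
    by rewrite /x1 mulrDr mulrA eps2; ring.
  have Is : I (s0 + eps * (u - x s0)) by apply: JI; rewrite /J/= e.
  by exists (s0 + eps * (u - x s0)) => //; rewrite xI.
have I0' : I !=set0 by exists s0.
have [lp up] := (lower_end_proper I0', upper_end_proper I0').
have z_end (F : set_system R) : ProperFilter F -> F I -> forall Q : R * R,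
    (x s, z s) @[s --> F] --> Q -> Q.2 = z s0.
  move=> PF FI Q /cvg_pair_snd zQ; have zc : z s @[s --> F] --> z s0.
    apply: cvg_near_cst; apply: filterS FI => s; exact: zI.
  exact: (cvg_unique _ zQ zc).
have lI : lower_end I I by exists s0 => // s [].
have uI : upper_end I I by exists s0 => // s [].
have x_end (F : set_system R) : ProperFilter F -> F I ->
    (forall u, 0 < u -> F [set s | I s /\ x s <= u]) ->
    (x s, z s) @[s --> F] --> (0, z s0).
  move=> PF FI xF; have zc : z s @[s --> F] --> z s0.
    apply: cvg_near_cst; apply: filterS FI => s; exact: zI.
  suff xc : x s @[s --> F] --> 0 by exact: (cvg_pair xc zc).
  apply/cvgrPdist_lt => e e0; have := xF (e / 2) (divr_gt0 e0 (ltr0Sn R 1)).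
  apply: filterS => s [Is xs]; rewrite sub0r normrN gtr0_norm ?x0//.
  by apply: le_lt_trans xs _; rewrite ltr_pdivrMr// ltr_pMr// ltr1n.
have gammaE : generating_curve I x z = [set Q : R * R | 0 <= Q.1 /\ Q.2 = z s0].
  apply/seteqP; split.
    move=> Q [[s Is <-]|[Q1 H]] /=; first by rewrite zI// ltW// x0.
    split; first by rewrite Q1.
    by case: H => h; [exact: (z_end _ lp lI)|exact: (z_end _ up uI)].
  move=> [u v] /= [u0 ->]; move: u0; rewrite le_eqVlt => /predU1P[<-|u0]; last first.
    by have [s Is <-] := onto u u0; left; exists s => //; rewrite zI.
  right; split => //=.
  (* The sign of [eps] tells which end of [I] runs into the axis. *)
  have [e0|/ltW e0] := leP 0 eps; [left|right]; apply: x_end => // w w0;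
    have [s Is xs] := onto w w0; exists s => // t [It ts]; split => //;
    by rewrite -xs !xI// /x1; nra.
by rewrite gammaE; exact: plane_of_half_line.
Qed.

End PlaneCase.

(** * The classification *)

Section MainCases.
Context {R : realType}.
Implicit Types (I J : set R) (x z th T Z f : R -> R) (a kap : R).

(** [kap] is the logarithm of the absolute value of the first integral; multiplying by [eps] is what
    makes the constant positive. *)
Lemma angle_setup a I x z th s0 : a != 0 -> maximal_linear_weingarten a I x z th ->
  I s0 -> sin (th s0) != 0 ->
  exists kap T, [/\ forall s, I s -> 0 < T s < pi,
    forall s, I s -> x s = angle_radius a kap (T s),
    forall t, 0 < t < pi -> exists2 s, I s & T s = t,
    (forall s u, I s -> I u -> s < u -> T s < T u) \/
    (forall s u, I s -> I u -> s < u -> T u < T s) &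
    forall Z, (forall t, 0 < t < pi -> is_derive t 1 Z (angle_radius a kap t / a)) ->
      exists k, forall s, I s -> z s = Z (T s) + k].
Proof.
move=> a0 mlw I0 sn0; have [lw _] := mlw; have [[_ _ itvI _] _] := lw.
have [eps [rho [eps2 T0 sinrho cosrho]]] := angle_shift sn0.
pose c := eps * (sin (th s0) * expR (- a * ln (x s0))).
have sinT s : I s -> sin (th s - rho) = c * expR (a * ln (x s)).
  move=> Is; rewrite sinrho /c (first_integral lw I0 Is) -!mulrA -expRD.
  by rewrite mulNr addNr expR0 mulr1.
have c0 : 0 < c.
  by rewrite /c mulrA mulr_gt0 ?expR_gt0// -sinrho sin_gt0_pi.
have Tpi : forall s, I s -> 0 < th s - rho < pi.
  apply: (angle_in_0pi (T := fun s => th s - rho) itvI) I0 T0.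
  - move=> s Is; have [_ _ _ dth] := linear_weingartenP lw Is.
    exact: is_derive_continuous (is_deriveBfun dth (is_derive_cstfun rho s)).
  - by move=> s Is; rewrite sinT// mulr_gt0// expR_gt0.
have xT s : I s -> x s = angle_radius a (ln c) (th s - rho).
  move=> Is; have [x0 _ _ _] := linear_weingartenP lw Is.
  rewrite /angle_radius sinT// lnM ?posrE ?expR_gt0// expRK.
  by rewrite addrAC subrr add0r mulrC mulKf// lnK// posrE.
have [onto mono ZT] := angle_ode_maximal a0 eps2 mlw sinrho cosrho Tpi xT.
by exists (ln c), (fun s => th s - rho).
Qed.

Lemma positive_case a I x z th s0 : 0 < a -> maximal_linear_weingarten a I x z th ->
  I s0 -> sin (th s0) != 0 ->
  let gamma := generating_curve I x z in
  let S := surface_of_revolution gamma in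
  [/\ exists J f, [/\ is_interval J, bounded_set J, gamma = zgraph J f &
        concave_function J f],
      is_ovaloid S & a = 1 -> is_round_sphere S].
Proof.
move=> a0 mlw I0 sn0; have an0 : a != 0 by rewrite gt_eqF.
have [kap [T [Tpi xT onto mono ZT]]] := angle_setup an0 mlw I0 sn0.
have pi0 := pi_gt0 R.
have [Z0 dZ0] : exists Z0 : R -> R, forall t, -1 < t < pi + 1 ->
    is_derive t 1 Z0 (sin_radius a kap (sin t) / a).
  apply: antiderivative; first by lra.
  move=> t _; apply: continuousM; last exact: cst_continuous.
  apply: (@continuous_comp _ _ _ sin (sin_radius a kap)).
    exact: continuous_sin.
  exact: sin_radius_continuous.
have [k zk] : exists k, forall s, I s -> z s = Z0 (T s) + k.
  apply: ZT => t tpi; rewrite -sin_radius_sin//.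
  by apply: dZ0; move: tpi => /andP[? ?]; apply/andP; split; lra.
pose Z t := Z0 t + k.
have dZ t : -1 < t < pi + 1 -> is_derive t 1 Z (sin_radius a kap (sin t) / a).
  move=> tpi; apply: (is_derive_eqfun (is_deriveDfun (dZ0 t tpi) (is_derive_cstfun k t))).
  by rewrite addr0.
pose f := positive_profile a kap Z; pose p := Z 0; pose q := Z pi.
have Zlt := positive_profile_Z_lt a0 dZ; have Zonto := positive_profile_Z_onto a0 dZ.
have fZ := positive_profile_Z a0 dZ; have cf := positive_profile_continuous a0 dZ.
have fle := positive_profile_le a0 dZ; have fge := positive_profile_ge a0 dZ.
have fgt0 := positive_profile_gt0 a0 dZ.
have conc := positive_profile_concave a0 dZ.
rewrite -/p -/q in Zlt Zonto fle fge fgt0 conc.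
have pq : p < q.
  have /andP[h1 h2] := Zlt _ (Tpi s0 I0); exact: lt_trans h1 h2.
have fp : f p = 0 := fle p (lexx p); have fq : f q = 0 := fge q (lexx q).
have f_ge0 t : p <= t <= q -> 0 <= f t.
  by move=> _; exact: sin_radius_ge0.
have zT s : I s -> z s = Z (T s) by exact: zk.
have xf s : I s -> x s = f (z s).
  move=> Is; have tpi := Tpi s Is; rewrite xT// zT// /f fZ ?sin_radius_sin//.
  by move: tpi => /andP[/ltW -> /ltW ->].
have I0' : I !=set0 by exists s0.
have [F0 [F1 [PF0 PF1 F01 ends]]] := angle_ends I0' onto mono.
have FI F : F = lower_end I \/ F = upper_end I -> F I.
  by case=> ->; exists s0 => // s [].
(* Along the curve [x = f(z)] with [f] continuous, so convergence of the height to a zero of [f] is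
   enough. *)
have cvg_end (F : set_system R) c : ProperFilter F -> F I -> f c = 0 ->
    (forall e, 0 < e -> F [set s | `|c - z s| < e]) ->
    (x s, z s) @[s --> F] --> (0, c).
  move=> PF FFI fc0 Fz; have zc : z s @[s --> F] --> c.
    by apply/cvgrPdist_lt => e /Fz.
  suff xc : x s @[s --> F] --> 0 by exact: (cvg_pair xc zc).
  have fzc : f (z s) @[s --> F] --> f c.
    exact: (@cvg_comp _ _ _ _ f _ _ _ zc (cf c)).
  rewrite -fc0; apply: cvg_trans fzc; apply: near_eq_cvg.
  by apply: filterS FFI => s Is; rewrite /= xf.
have F0I : F0 I by apply: FI; case: F01 => -[-> _]; [left|right].
have F1I : F1 I by apply: FI; case: F01 => -[_ ->]; [right|left].
have c0 : (x s, z s) @[s --> F0] --> (0, p).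
  apply: cvg_end => // e e0.
  have [t0 t0pi H] := positive_profile_end dZ (or_introl erefl) (erefl p) e0.
  have [+ _] := ends t0 t0pi; apply: filterS => s [Is Ts] /=.
  by rewrite zT//; apply: H; [exact: Tpi|rewrite eqxx].
have c1 : (x s, z s) @[s --> F1] --> (0, q).
  apply: cvg_end => // e e0.
  have [t0 t0pi H] := positive_profile_end dZ (or_intror erefl) (erefl q) e0.
  have [_] := ends t0 t0pi; apply: filterS => s [Is Ts] /=.
  by rewrite zT//; apply: H; [exact: Tpi|rewrite gt_eqF].
pose J := [set w | p <= w <= q].
have gammaE : generating_curve I x z = zgraph J f.
  rewrite (generating_curveE x z F01); apply/seteqP; split.
    (* By uniqueness of limits, the only axis points added are [(0, p)] and [(0, q)], which the
       graph contains because [f] vanishes at [p] and [q]. *)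
    move=> Q [[s Is <-]|[Q1 [h|h]]].
    - exists (z s); last by rewrite -xf.
      by rewrite /J/= zT//; have /andP[/ltW -> /ltW ->] := Zlt _ (Tpi s Is).
    - have <- : (0, p) = Q by exact: (cvg_unique _ c0 h).
      exists p; last by rewrite fp.
      by rewrite /J/= lexx ltW.
    - have <- : (0, q) = Q by exact: (cvg_unique _ c1 h).
      exists q; last by rewrite fq.
      by rewrite /J/= lexx ltW.
  move=> _ [w /andP[pw wq] <-].
  move: pw; rewrite le_eqVlt => /predU1P[<-|pw].
    by right; rewrite fp; split => //; left.
  move: wq; rewrite le_eqVlt => /predU1P[->|wq].
    by right; rewrite fq; split => //; right.
  have [|t tpi Zt] := Zonto w; first by rewrite pw.
  have [s Is Ts] := onto t tpi.
  have zw : z s = w by rewrite zT// Ts.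
  by left; exists s => //; rewrite xf// zw.
have SE : surface_of_revolution (generating_curve I x z) = revolved p q f.
  by rewrite gammaE surface_of_revolution_zgraph.
rewrite /= SE; split.
- exists J, f; split => //.
  + move=> u v /andP[pu _] /andP[_ vq] w /andP[uw wv].
    by rewrite /J/= (le_trans pu uw) (le_trans wv vq).
  + exact: (@bounded_setI _ p q).
  + apply: convex_functionI => u v l Ju Jv l01.
    by rewrite !mulrN -opprD lerN2; exact: conc.
- apply: is_ovaloid_revolved => //.
  exact: (positive_profile_tangent a0 dZ).
- move=> a1; have [c [r [r0 pc qc circ]]] := positive_profile_circle a0 dZ a1.
  rewrite -/p -/q -/f in pc qc circ.
  exists ((0, 0), c), r => //; apply/seteqP; split => -[[X Y] W].
    by move=> [/= Wpq]; rewrite circ// /round_sphere /dot3/= !subr0 -!expr2 => ->; ring.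
  rewrite /round_sphere /dot3/= !subr0 -!expr2 => e.
  have Wpq : p <= W <= q.
    have : `|W - c| <= r.
      rewrite -ler_sqr ?nnegrE ?(ltW r0)// real_normK ?num_real// -e lerDr.
      by rewrite addr_ge0// sqr_ge0.
    by rewrite ler_norml pc qc => /andP[? ?]; apply/andP; split; lra.
  by split => //=; rewrite circ// -e; ring.
Qed.

Lemma negative_case a I x z th s0 : a < 0 -> maximal_linear_weingarten a I x z th ->
  I s0 -> sin (th s0) != 0 ->
  let gamma := generating_curve I x z in
  let S := surface_of_revolution gamma in
  (exists J f, [/\ is_interval J, gamma = zgraph J f, convex_function (J : set R) f,
     -1 <= a -> J = setT &
     a < -1 -> bounded_set J /\ asymptotic_parallel_lines I x z]) /\
  is_catenoid_type S.
Proof.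
move=> a0 mlw I0 sn0; have an0 : a != 0 by rewrite lt_eqF.
have [kap [T [Tpi xT onto mono ZT]]] := angle_setup an0 mlw I0 sn0.
have pi0 := pi_gt0 R.
have [Z0 dZ0] : exists Z0 : R -> R, forall t, 0 < t < pi ->
    is_derive t 1 Z0 (angle_radius a kap t / a).
  apply: antiderivative => // t tpi; apply: continuousM; last exact: cst_continuous.
  exact: is_derive_continuous (is_derive_angle_radius a kap tpi).
have [k zk] := ZT Z0 dZ0.
pose Z t := Z0 t + k.
have dZ t : 0 < t < pi -> is_derive t 1 Z (angle_radius a kap t / a).
  move=> tpi; apply: (is_derive_eqfun (is_deriveDfun (dZ0 t tpi) (is_derive_cstfun k t))).
  by rewrite addr0.
pose f := negative_profile a kap Z; pose J := negative_domain Z.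
have fZ := negative_profile_Z a0 dZ.
have zT s : I s -> z s = Z (T s) by exact: zk.
have xf s : I s -> x s = f (z s).
  by move=> Is; rewrite xT// zT// /f fZ//; exact: Tpi.
have I0' : I !=set0 by exists s0.
have [F0 [F1 [PF0 PF1 F01 ends]]] := angle_ends I0' onto mono.
have x_lt M : F0 [set s | M < x s] /\ F1 [set s | M < x s].
  have [t0 /andP[t00 t0pi] H] := negative_profile_ends kap a0 M.
  have t0pi' : 0 < t0 < pi by apply/andP; split => //; lra.
  have t1pi : 0 < pi - t0 < pi by apply/andP; split; lra.
  have [[h0 _] [_ h1]] := (ends t0 t0pi', ends (pi - t0) t1pi).
  split.
    by apply: filterS h0 => s [Is Ts] /=; rewrite xT//; apply: H; [exact: Tpi|left].
  by apply: filterS h1 => s [Is Ts] /=; rewrite xT//; apply: H; [exact: Tpi|right].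
(* The radius tends to infinity at both ends, so no axis point is added; [1] is an arbitrary
   positive threshold. *)
have no_end (F : set_system R) (Q : R * R) : ProperFilter F -> F [set s | 1 < x s] ->
    Q.1 = 0 -> ~ (x s, z s) @[s --> F] --> Q.
  move=> PF F1x Q1 /cvg_pair_fst; rewrite Q1 => x0.
  have F0x : F [set s | x s < 1] by exact: cvgr_lt x0 _ ltr01.
  have [s [/= h1 h2]] := filter_ex (filterI F1x F0x).
  by have := lt_trans h1 h2; rewrite ltxx.
have gammaE : generating_curve I x z = zgraph J f.
  rewrite (generating_curveE x z F01); apply/seteqP; split.
    move=> Q [[s Is <-]|[Q1 [h|h]]].
    - exists (z s); last by rewrite -xf.
      by rewrite zT//; exists (T s) => //; exact: Tpi.
    - by case: (no_end _ _ PF0 (x_lt 1).1 Q1 h).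
    - by case: (no_end _ _ PF1 (x_lt 1).2 Q1 h).
  move=> _ [_ [t tpi <-] <-]; have [s Is Ts] := onto t tpi.
  by left; exists s => //; rewrite xf// zT// Ts.
have itvJ : is_interval J := negative_domain_interval dZ.
have convf : convex_function (J : set R) f.
  by apply: convex_functionI => u v l Ju Jv l01; exact: negative_profile_convex.
have JT : -1 <= a -> J = setT by exact: negative_domain_setT.
have Jb : a < -1 -> bounded_set J.
  move=> a1; have [p [q [_ H _]]] := negative_domain_ends a0 dZ a1.
  by apply: (@bounded_setI _ p q) => _ [t tpi <-]; exact: H.
rewrite /=; split; last first.
  exists J, f; split; first split => //.
  - exact: negative_domain_nonempty.
  - exact: negative_domain_open a0 dZ.
  - by have [/JT|/Jb] := leP (-1) a; [left|right].
  - split => //; first by move=> t _; exact: angle_radius_gt0.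
    by rewrite gammaE.
exists J, f; split => // a1; split; first exact: Jb.
have [p [q [pq _ H]]] := negative_domain_ends a0 dZ a1.
have asym (F : set_system R) (c : R) : ProperFilter F ->
    (forall M, F [set s | M < x s]) ->
    (forall e, 0 < e -> F [set s | `|c - z s| < e]) ->
    asymptotic F x z (line (0, c) (1, 0)).
  move=> PF Fx Fz; split.
    apply/cvgryPgt => M; apply: filterS (Fx M) => s /= Mx.
    rewrite prod_normE /= lt_max; apply/orP; left.
    by apply: lt_le_trans Mx _; exact: ler_norm.
  move=> e e0; apply: filterS (Fz e e0) => s /= ze.
  exists (x s, c).
    by exists (x s) => //; congr (_, _) => /=; rewrite /GRing.scale/=; ring.
  by rewrite prod_normE /= subrr normr0 distrC max_r.
have a0q : asymptotic F0 x z (line (0, q) (1, 0)).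
  apply: asym => [M|e e0]; first exact: (x_lt M).1.
  have [t0 t0pi He] := H e e0; have [+ _] := ends t0 t0pi.
  apply: filterS => s [Is Ts] /=; rewrite zT//.
  by have [+ _] := He _ (Tpi s Is); apply.
have a1p : asymptotic F1 x z (line (0, p) (1, 0)).
  apply: asym => [M|e e0]; first exact: (x_lt M).2.
  have [t0 t0pi He] := H e e0.
  have t1pi : 0 < pi - t0 < pi.
    by move: t0pi => /andP[? ?]; apply/andP; split; lra.
  have [_] := ends (pi - t0) t1pi.
  apply: filterS => s [Is Ts] /=; rewrite zT//.
  by have [_] := He _ (Tpi s Is); apply.
have lines (c d : R) : c != d -> line (0, c) (1, 0) <> line (0, d) (1, 0).
  move=> cd e; have : line (0, c) (1, 0) ((0, c) : R * R).
    by exists 0 => //; rewrite scale0r addr0.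
  rewrite e => -[t _ [_ /eqP]]; rewrite scaler0 addr0 eq_sym.
  by rewrite (negbTE cd).
have v0 : (1, 0) != 0 :> R * R.
  by apply/eqP => /(congr1 fst)/eqP; rewrite /= oner_eq0.
(* The upper asymptote belongs to the end where the angle tends to [0]; the orientation decides
   whether that is the lower or the upper end of [I]. *)
case: F01 => -[E0 E1]; rewrite E0 in a0q; rewrite E1 in a1p.
  by exists (0, q), (0, p), (1, 0); split => //; apply: lines; rewrite gt_eqF.
by exists (0, p), (0, q), (1, 0); split => //; apply: lines; rewrite lt_eqF.
Qed.

End MainCases.

Unset Implicit Arguments.

Theorem theorem4p1 (R : realType) (a : R) (a_neq0 : a != 0)
    (I : set R) (x z th : R -> R)
    (gammaP : maximal_linear_weingarten a I x z th) :
  let gamma := generating_curve I x z in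
  let S := surface_of_revolution gamma in
  [\/ is_plane S, is_ovaloid S | is_catenoid_type S] /\
  (~ is_plane S ->
    (0 < a ->
      [/\ exists (J : set R) (f : R -> R),
            [/\ is_interval J, bounded_set J, gamma = zgraph J f &
                concave_function J f],
          is_ovaloid S &
          a = 1 -> is_round_sphere S]) /\
    (a < 0 ->
      (exists (J : set R) (f : R -> R),
        [/\ is_interval J, gamma = zgraph J f, convex_function (J : set R) f,
            -1 <= a -> J = setT &
            a < -1 -> bounded_set J /\ asymptotic_parallel_lines I x z]) /\
      is_catenoid_type S)).
Proof.
move=> gamma S; have [[[[s0 I0] _ _ _] _] _] := gammaP.
have [sin0|sin0] := eqVneq (sin (th s0)) 0.
  have Splane : is_plane S := horizontal_curve gammaP I0 sin0.
  by split; [constructor 1|].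
have pos a0 := positive_case a0 gammaP I0 sin0.
have neg a0 := negative_case a0 gammaP I0 sin0.
split; last by move=> _; split.
have [a0|a0|a0] := ltgtP a 0; last by rewrite a0 eqxx in a_neq0.
- by constructor 3; have [] := neg a0.
- by constructor 2; have [] := pos a0.
Qed.
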